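(* Let $A = U + U^{-1} - 2I$, and consider the equation $\dot{p}=Ap$, whose solution is $p(t)=\mathrm{e}^{At}p(0)$, $t \ge 0$. (1) Regard $A$ as a bounded operator on $\ell^2$. The $\ell^2$-induced operator norm of $\mathrm{e}^{At}$ satisfies $\|\mathrm{e}^{At}\| = 1$ for all $t\ge 0$. For every $p(0)\in\ell^2$, $\|p(t)\|_\infty \to 0$ as $t\to\infty$; in addition, $p(t)$ converges to zero weakly in $\ell^2$, that is, $\langle p(t),y\rangle \to 0$ as $t\to\infty$ for every $y\in\ell^2$. (2) Regard $A$ as a bounded operator on $\ell^\infty$. The $\ell^\infty$-induced operator norm of $\mathrm{e}^{At}$ satisfies $\|\mathrm{e}^{At}\|=1$ for all $t\ge 0$. Also, in the $\ell^\infty$-induced operator norm, $\|A\mathrm{e}^{At}\|\to 0$ as $t\to\infty$. Thus, for every $p(0)\in\ell^\infty$, $\dot{p}(t)$ converges to zero in $\ell^\infty$ as $t\to\infty$, and, moreover, if $p(0)$ belongs to the range $A\ell^\infty=\{Ax : x\in\ell^\infty\}$, then $p(t)$ converges to zero in $\ell^\infty$ as $t\to\infty$.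
   Context: All sequences are real and indexed by $n\in\mathbb{Z}$. $\ell^2$ is the Hilbert space of square-summable sequences $x=(x_n)_{n\in\mathbb{Z}}$ with inner product $\langle x,y\rangle=\sum_{n\in\mathbb{Z}} x_n y_n$; $\ell^\infty$ is the Banach space of bounded sequences with norm $\|x\|_\infty=\sup_n|x_n|$. $U$ is the bilateral right shift, $(Ux)_n=x_{n-1}$, with inverse $(U^{-1}x)_n=x_{n+1}$; both are bounded operators on $\ell^2$ and on $\ell^\infty$. For a bounded operator $A$, $\mathrm{e}^{At}=\sum_{k\ge 0} A^k t^k/k!$. Componentwise, $\dot p=Ap$ reads $\dot p_n=p_{n+1}+p_{n-1}-2p_n$, $n\in\mathbb{Z}$. *)

(* Defs.v *)
From HB Require Import structures.
From mathcomp Require Import all_boot all_order all_algebra.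
From mathcomp Require Import all_classical all_reals all_analysis.
From mathcomp Require Import finmap ring lra.
Set Implicit Arguments.
Unset Strict Implicit.
Unset Printing Implicit Defensive.
Import Order.TTheory GRing.Theory Num.Theory.
Import numFieldNormedType.Exports.
Local Open Scope classical_set_scope.
Local Open Scope ring_scope.

(** ** Bounded operators on a normed space *)

Section BoundedOperators.
Context {R : realType} {V : normedModType R}.

Definition bounded_operator (f : V -> V) : Prop :=
  linear f /\ exists M : R, forall x, `|f x| <= M * `|x|.

Definition bounded_operator_pred : {pred V -> V} :=
  fun f => `[< bounded_operator f >].

Lemma bounded_operator_submod_closed : submod_closed bounded_operator_pred.
Proof.
split.
  apply/asboolP; split; first by move=> a x y; rewrite -![0 _]/(0 : V) scaler0 addr0.
  by exists 0 => x; rewrite -[0 x]/(0 : V) normr0 mul0r.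
move=> a f g /asboolP[lf [M fM]] /asboolP[lg [N gN]]; apply/asboolP; split.
  move=> b x y.
  rewrite -![(_ + g) _]/(a *: f _ + g _) lf lg !scalerDr !scalerA (mulrC a b) -!addrA.
  by congr (_ + _); rewrite addrCA.
exists (`|a| * M + N) => x; rewrite -[(_ + g) x]/(a *: f x + g x).
rewrite (le_trans (ler_normD _ _))// mulrDl lerD// normrZ -mulrA.
by rewrite ler_wpM2l.
Qed.

HB.instance Definition _ := GRing.isSubmodClosed.Build _ _
  bounded_operator_pred bounded_operator_submod_closed.

Record bop : Type := Bop {
  bop_fun :> V -> V;
  bop_subproof : bop_fun \in bounded_operator_pred }.

HB.instance Definition _ := [isSub for bop_fun].
HB.instance Definition _ := [Choice of bop by <:].
HB.instance Definition _ := [SubChoice_isSubLmodule of bop by <:].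

Lemma bopP (A : bop) : bounded_operator A.
Proof. exact/asboolP/bop_subproof. Qed.

Definition mk_bop (f : V -> V) (Pf : bounded_operator f) : bop :=
  Bop (introT (asboolP _) Pf).

Lemma bop_ext (A B : bop) : A =1 B -> A = B.
Proof. by move=> AB; exact/val_inj/funext. Qed.

Lemma bop_linear (A : bop) : linear A. Proof. by case: (bopP A). Qed.

HB.instance Definition _ (A : bop) :=
  GRing.isLinear.Build R V V *:%R A (bop_linear A).

Lemma bopD (A B : bop) x : (A + B) x = A x + B x. Proof. by []. Qed.
Lemma bopZ a (A : bop) x : (a *: A) x = a *: A x. Proof. by []. Qed.
Lemma bopN (A : bop) x : (- A) x = - A x. Proof. by []. Qed.

Definition opnorm (A : bop) : R := sup [set `|A x| | x in [set x | `|x| <= 1]].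

Lemma opnorm_has_sup (A : bop) :
  has_sup [set `|A x| | x in [set x | `|x| <= 1]].
Proof.
have [_ [M AM]] := bopP A; split.
  by exists `|A 0|, 0 => //=; rewrite normr0.
exists `|M| => _ [x /= x1 <-]; rewrite (le_trans (AM x))//.
rewrite (le_trans (ler_wpM2r _ (ler_norm M)))//.
by rewrite ler_piMr.
Qed.

Lemma opnorm_ub (A : bop) x : `|x| <= 1 -> `|A x| <= opnorm A.
Proof.
by move=> x1; apply: (sup_upper_bound (opnorm_has_sup A)); exists x.
Qed.

Lemma opnorm_le (A : bop) M :
  (forall x, `|x| <= 1 -> `|A x| <= M) -> opnorm A <= M.
Proof.
move=> AM; apply: ge_sup; first by case: (opnorm_has_sup A).
by move=> _ [x /= x1 <-]; exact: AM.
Qed.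

Lemma opnorm_ge0 (A : bop) : 0 <= opnorm A.
Proof. by rewrite -(normr0 V) -(linear0 A) opnorm_ub// normr0. Qed.

Lemma le_opnorm (A : bop) x : `|A x| <= opnorm A * `|x|.
Proof.
have [->|x0] := eqVneq x 0; first by rewrite linear0 !normr0 mulr0.
have nx : 0 < `|x| by rewrite normr_gt0.
rewrite -ler_pdivrMr// mulrC -[X in X * _]ger0_norm ?invr_ge0//.
rewrite -normrZ -linearZ opnorm_ub// normrZ ger0_norm ?invr_ge0//.
by rewrite mulVf// gt_eqF.
Qed.

Lemma opnormD (A B : bop) : opnorm (A + B) <= opnorm A + opnorm B.
Proof.
apply: opnorm_le => x x1; rewrite bopD (le_trans (ler_normD _ _))//.
by rewrite lerD// opnorm_ub.
Qed.

Lemma opnormZ_le a (A : bop) : opnorm (a *: A) <= `|a| * opnorm A.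
Proof.
by apply: opnorm_le => x x1; rewrite bopZ normrZ ler_wpM2l// opnorm_ub.
Qed.

Lemma opnormZ a (A : bop) : opnorm (a *: A) = `|a| * opnorm A.
Proof.
apply/eqP; rewrite eq_le opnormZ_le/=.
have [->|a0] := eqVneq a 0; first by rewrite normr0 mul0r opnorm_ge0.
rewrite -ler_pdivlMl ?normr_gt0// -normfV.
by rewrite (le_trans _ (opnormZ_le _ _))// scalerA mulVf// scale1r.
Qed.

Lemma opnorm_eq0 (A : bop) : opnorm A = 0 -> A = 0.
Proof.
move=> A0; apply: bop_ext => x; apply/eqP; rewrite -normr_le0.
by rewrite (le_trans (le_opnorm A x))// A0 mul0r.
Qed.

HB.instance Definition _ :=
  Lmodule_isNormed.Build R bop opnormD opnormZ opnorm_eq0.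

Lemma bop_normE (A : bop) : `|A| = opnorm A. Proof. by []. Qed.

Lemma bop_id_subproof : bounded_operator (@idfun V).
Proof. by split => //; exists 1 => x; rewrite mul1r. Qed.
Definition bop_id : bop := mk_bop bop_id_subproof.

Lemma bop_comp_subproof (A B : bop) : bounded_operator (A \o B).
Proof.
split; first by move=> a x y /=; rewrite !linearP.
exists (opnorm A * opnorm B) => x /=.
rewrite (le_trans (le_opnorm _ _))// -mulrA.
by rewrite ler_wpM2l ?opnorm_ge0// le_opnorm.
Qed.
Definition bop_comp (A B : bop) : bop := mk_bop (bop_comp_subproof A B).

Lemma bop_compA : associative bop_comp.
Proof. by move=> A B C; exact: bop_ext. Qed.
Lemma bop_comp1l : left_id bop_id bop_comp.
Proof. by move=> A; exact: bop_ext. Qed.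
Lemma bop_comp1r : right_id bop_id bop_comp.
Proof. by move=> A; exact: bop_ext. Qed.
Lemma bop_compDl : left_distributive bop_comp +%R.
Proof. by move=> A B C; exact: bop_ext. Qed.
Lemma bop_compDr : right_distributive bop_comp +%R.
Proof. by move=> A B C; apply: bop_ext => x; exact: linearD. Qed.

(* Multiplication of operators is composition; the ring may be trivial since
   V is allowed to be the zero space. *)
HB.instance Definition _ := GRing.Zmodule_isPzRing.Build bop
  bop_compA bop_comp1l bop_comp1r bop_compDl bop_compDr.

(* The limit is taken in the operator norm. *)
Definition bexp (A : bop) (t : R) : bop :=
  limn (series (fun k : nat => (t ^+ k / (k`!)%:R) *: A ^+ k)).

(* [p] is a solution on [0, +oo[ of p' = A p; the difference quotients are
   restricted to 0 <= t + h, so that the derivative is one-sided at t = 0. *)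
Definition solves (A : bop) (p : R -> V) : Prop :=
  forall t : R, 0 <= t ->
    h^-1 *: (p (t + h) - p t) @[h --> within [set h | 0 <= t + h] 0^'] --> A (p t).

End BoundedOperators.
Arguments bop {R} V.

(** ** Bilateral real sequences *)

Section Sequences.
Context {R : realType}.
Implicit Types x y u : int -> R.

Definition supnorm x : R := sup (range (fun n => `|x n|)).

(* Unconditional sum over all integers (meaningful for absolutely summable u):
   sum of the positive part minus sum of the negative part. *)
Definition zsum u : R :=
  fine (\esum_(n in [set: int]) ((EFin \o u)^\+ n)%E) -
  fine (\esum_(n in [set: int]) ((EFin \o u)^\- n)%E).

Definition dotz x y : R := zsum (fun n => x n * y n).

Definition square_summable x : Prop :=
  summable [set: int] (fun n => (x n ^+ 2)%:E).

Definition bounded_seq x : Prop := bounded_fun x.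

Definition sqnorm x : \bar R := \esum_(n in [set: int]) (x n ^+ 2)%:E.

Lemma square_summableE x : square_summable x <-> (sqnorm x < +oo)%E.
Proof.
rewrite /square_summable /summable /sqnorm.
by under eq_esum do rewrite gee0_abs ?lee_fin ?sqr_ge0//.
Qed.

Lemma sqnorm_ge0 x : (0 <= sqnorm x)%E.
Proof. by apply: esum_ge0 => n _; rewrite lee_fin sqr_ge0. Qed.

Lemma dotzz x : dotz x x = fine (sqnorm x).
Proof.
rewrite /dotz /zsum /sqnorm.
have x0 n : (0%E <= (x n * x n)%:E)%E by rewrite lee_fin -expr2 sqr_ge0.
rewrite [X in _ - fine X]esum1 ?fine0 ?subr0; last first.
  by move=> n _; rewrite funenegE; apply/max_idPr;
     rewrite /= lee_fin oppr_le0 -lee_fin.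
congr fine; apply: eq_esum => n _; rewrite funeposE /= expr2.
exact/max_idPl.
Qed.

Lemma dotzz_ge0 x : 0 <= dotz x x.
Proof. by rewrite dotzz fine_ge0// sqnorm_ge0. Qed.

Lemma sqnormE x : square_summable x -> sqnorm x = (dotz x x)%:E.
Proof.
move=> /square_summableE xoo; rewrite dotzz fineK//.
by rewrite ge0_fin_numE ?sqnorm_ge0.
Qed.

Lemma sqnorm_le x (M : R) :
  (forall F : {fset int}, \sum_(n <- F) x n ^+ 2 <= M) -> (sqnorm x <= M%:E)%E.
Proof.
move=> xM; apply: ge_ereal_sup => _ [A [finA _] <-].
by rewrite fsbig_finite// sumEFin lee_fin.
Qed.

Lemma sqnorm_fset x : square_summable x ->
  forall F : {fset int}, \sum_(n <- F) x n ^+ 2 <= dotz x x.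
Proof.
move=> sx F; rewrite -lee_fin -sqnormE// -sumEFin; apply: ereal_sup_ubound.
exists [set` F] => /=; first by split => //; exact: finite_fset.
by rewrite fsbig_finite//= set_fsetK.
Qed.

Lemma coord_le_l2 x n : square_summable x -> `|x n| <= Num.sqrt (dotz x x).
Proof.
move=> sx; rewrite -sqrtr_sqr ler_wsqrtr//.
by rewrite (le_trans _ (sqnorm_fset sx [fset n]%fset))// big_seq_fset1.
Qed.

Lemma square_summableZD a x y : square_summable x -> square_summable y ->
  square_summable (a *: x + y).
Proof.
move=> sx sy; apply/square_summableE.
apply: (@le_lt_trans _ _ (2 * a ^+ 2 * dotz x x + 2 * dotz y y)%:E);
  last exact: ltry.
apply: sqnorm_le => F.
apply: (@le_trans _ _ (\sum_(n <- F) (2 * a ^+ 2 * x n ^+ 2 + 2 * y n ^+ 2))).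
  apply: ler_sum => n _; rewrite -[(_ + y) n]/(a * x n + y n).
  by rewrite -subr_ge0 (_ : _ - _ = (a * x n - y n) ^+ 2) ?sqr_ge0//; ring.
rewrite big_split/= -!mulr_sumr lerD// ler_wpM2l ?sqnorm_fset//.
by rewrite mulr_ge0 ?sqr_ge0.
Qed.

Lemma square_summable0 : square_summable (0 : int -> R).
Proof.
apply/square_summableE; apply: (@le_lt_trans _ _ 0%:E); last exact: ltry.
by apply: sqnorm_le => F; rewrite big1// => n _; rewrite -[0 n]/(0 : R) expr0n.
Qed.

Lemma dotz_le x (M : R) :
  (forall F : {fset int}, \sum_(n <- F) x n ^+ 2 <= M) -> 0 <= M ->
  dotz x x <= M.
Proof.
move=> xM M0; rewrite dotzz -lee_fin fineK; first exact: sqnorm_le.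
by rewrite ge0_fin_numE ?sqnorm_ge0// (le_lt_trans (sqnorm_le xM))// ltry.
Qed.

End Sequences.

(** ** The spaces l^2 and l^oo over the integers *)

Section Ell2.
Context (R : realType).

Definition square_summable_pred : {pred int -> R} :=
  fun x => `[< square_summable x >].

Lemma square_summable_submod_closed : submod_closed square_summable_pred.
Proof.
split; first exact/asboolP/square_summable0.
by move=> a x y /asboolP sx /asboolP sy; exact/asboolP/square_summableZD.
Qed.

HB.instance Definition _ := GRing.isSubmodClosed.Build _ _
  square_summable_pred square_summable_submod_closed.

Record ell2 : Type := Ell2 {
  ell2_seq :> int -> R;
  ell2_subproof : ell2_seq \in square_summable_pred }.

HB.instance Definition _ := [isSub for ell2_seq].
HB.instance Definition _ := [Choice of ell2 by <:].
HB.instance Definition _ := [SubChoice_isSubLmodule of ell2 by <:].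

Lemma ell2P (x : ell2) : square_summable x.
Proof. exact/asboolP/ell2_subproof. Qed.

Definition mk_ell2 (x : int -> R) (Px : square_summable x) : ell2 :=
  Ell2 (introT (asboolP _) Px).

Definition ell2_norm (x : ell2) : R := Num.sqrt (dotz x x).

Lemma ell2_normD (x y : ell2) : ell2_norm (x + y) <= ell2_norm x + ell2_norm y.
Proof.
apply/ler_addgt0Pr => e e0; set a := ell2_norm x + e / 2.
set b := ell2_norm y + e / 2.
have a0 : 0 < a by rewrite ltr_wpDl ?sqrtr_ge0// divr_gt0.
have b0 : 0 < b by rewrite ltr_wpDl ?sqrtr_ge0// divr_gt0.
rewrite (_ : _ + e = a + b); last by rewrite /a /b; field.
have -> : a + b = Num.sqrt ((a + b) ^+ 2).
  by rewrite sqrtr_sqr ger0_norm// addr_ge0// ltW.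
apply: ler_wsqrtr.
have sqle (z : ell2) c : ell2_norm z <= c -> 0 < c ->
    forall F : {fset int}, \sum_(n <- F) z n ^+ 2 <= c ^+ 2.
  move=> zc c0 F; rewrite (le_trans (sqnorm_fset (ell2P z) F))//.
  rewrite -(sqr_sqrtr (dotzz_ge0 z)) lerXn2r// nnegrE ?sqrtr_ge0//.
  exact: ltW.
apply: dotz_le; last exact: sqr_ge0.
move=> F; apply: (@le_trans _ _ (\sum_(n <- F)
    ((1 + b / a) * x n ^+ 2 + (1 + a / b) * y n ^+ 2))).
  apply: ler_sum => n _; rewrite -[(x + y) n]/(x n + y n) -subr_ge0.
  rewrite (_ : _ - _ = (b * x n - a * y n) ^+ 2 / (a * b)).
    by rewrite divr_ge0 ?sqr_ge0// mulr_ge0// ltW.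
  by field; rewrite !gt_eqF.
rewrite big_split/= -!mulr_sumr.
rewrite (_ : (a + b) ^+ 2 = (1 + b / a) * a ^+ 2 + (1 + a / b) * b ^+ 2).
  rewrite lerD// ler_wpM2l ?sqle// ?addr_ge0 ?divr_ge0 ?(ltW a0) ?(ltW b0)//.
    by rewrite lerDl divr_ge0// ltW.
  by rewrite lerDl divr_ge0// ltW.
by field; rewrite !gt_eqF.
Qed.

Lemma ell2_normZ_le a (x : ell2) : ell2_norm (a *: x) <= `|a| * ell2_norm x.
Proof.
rewrite -sqrtr_sqr -sqrtrM ?sqr_ge0// ler_wsqrtr// dotz_le//.
  move=> F; under eq_bigr => n _ do rewrite -[(a *: x) n]/(a * x n) exprMn.
  by rewrite -mulr_sumr ler_wpM2l ?sqr_ge0// sqnorm_fset//; exact: ell2P.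
by rewrite mulr_ge0 ?sqr_ge0 ?dotzz_ge0.
Qed.

Lemma ell2_normZ a (x : ell2) : ell2_norm (a *: x) = `|a| * ell2_norm x.
Proof.
apply/eqP; rewrite eq_le ell2_normZ_le/=.
have [->|a0] := eqVneq a 0; first by rewrite normr0 mul0r sqrtr_ge0.
rewrite -ler_pdivlMl ?normr_gt0// -normfV.
by rewrite (le_trans _ (ell2_normZ_le _ _))// scalerA mulVf// scale1r.
Qed.

Lemma ell2_norm_eq0 (x : ell2) : ell2_norm x = 0 -> x = 0.
Proof.
move=> x0; apply/val_inj/funext => n; apply/eqP; rewrite -normr_le0.
by rewrite (le_trans (coord_le_l2 n (ell2P x)))// -/(ell2_norm x) x0.
Qed.

HB.instance Definition _ :=
  Lmodule_isNormed.Build R ell2 ell2_normD ell2_normZ ell2_norm_eq0.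

Lemma ell2_normE (x : ell2) : `|x| = Num.sqrt (dotz x x). Proof. by []. Qed.

Lemma ell2_shift_le (d : int) (x : ell2) (F : {fset int}) :
  \sum_(n <- F) (x (n + d)) ^+ 2 <= dotz x x.
Proof.
have inj : injective (fun n : int => n + d) by move=> m n /addIr.
rewrite (_ : \sum_(n <- F) _ =
  \sum_(n <- [fset (n + d)%R | n in F]%fset) x n ^+ 2).
  by apply: sqnorm_fset; exact: ell2P.
by rewrite big_imfset//= => m n _ _; exact: inj.
Qed.

Lemma square_summable_translate (d : int) (x : ell2) :
  square_summable (fun n => x (n + d)).
Proof.
apply/square_summableE; apply: le_lt_trans (ltry (dotz x x)).
by apply: sqnorm_le; exact: ell2_shift_le.
Qed.

Lemma translate2_subproof (d : int) :
  bounded_operator (fun x : ell2 => mk_ell2 (square_summable_translate d x)).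
Proof.
split; first by move=> a x y; exact: val_inj.
exists 1 => x; rewrite mul1r ler_wsqrtr// dotz_le ?dotzz_ge0//.
exact: ell2_shift_le.
Qed.

(* U2, Uinf are the right shift U and U2V, UinfV its inverse. *)
Definition U2 : bop ell2 := mk_bop (translate2_subproof (-1)).
Definition U2V : bop ell2 := mk_bop (translate2_subproof 1).
Definition A2 : bop ell2 := U2 + U2V - (2 : R) *: bop_id.

Lemma A2E (x : ell2) n : A2 x n = x (n + 1) + x (n - 1) - 2 * x n.
Proof. by rewrite [x (n + 1) + _]addrC. Qed.

End Ell2.

Section EllInf.
Context (R : realType).

Definition bounded_seq_pred : {pred int -> R} := fun x => `[< bounded_seq x >].

Lemma bounded_seqE (x : int -> R) :
  bounded_seq x <-> exists M, forall n, `|x n| <= M.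
Proof.
split=> [[M [_ xM]]|[M xM]].
  by exists (M + 1) => n; apply: xM => //; rewrite ltrDl.
by exists M; split; [exact: num_real|move=> N /ltW MN n _; exact: le_trans MN].
Qed.

Lemma bounded_seq_submod_closed : submod_closed bounded_seq_pred.
Proof.
split.
  by apply/asboolP/bounded_seqE; exists 0 => n; rewrite -[0 n]/(0 : R) normr0.
move=> a x y /asboolP/bounded_seqE[M xM] /asboolP/bounded_seqE[N yN].
apply/asboolP/bounded_seqE; exists (`|a| * M + N) => n.
rewrite -[(_ + y) n]/(a * x n + y n) (le_trans (ler_normD _ _))// lerD//.
by rewrite normrM ler_wpM2l.
Qed.

HB.instance Definition _ := GRing.isSubmodClosed.Build _ _
  bounded_seq_pred bounded_seq_submod_closed.

Record ellinf : Type := Ellinf {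
  ellinf_seq :> int -> R;
  ellinf_subproof : ellinf_seq \in bounded_seq_pred }.

HB.instance Definition _ := [isSub for ellinf_seq].
HB.instance Definition _ := [Choice of ellinf by <:].
HB.instance Definition _ := [SubChoice_isSubLmodule of ellinf by <:].

Lemma ellinfP (x : ellinf) : bounded_seq x.
Proof. exact/asboolP/ellinf_subproof. Qed.

Definition mk_ellinf (x : int -> R) (Px : bounded_seq x) : ellinf :=
  Ellinf (introT (asboolP _) Px).

Definition ellinf_norm (x : ellinf) : R := supnorm x.

Lemma ellinf_norm_ub (x : ellinf) n : `|x n| <= ellinf_norm x.
Proof.
have /bounded_seqE [M xM] := ellinfP x.
apply: ub_le_sup; last by exists n.
by exists M => _ [m _ <-].
Qed.

Lemma supnorm_le (x : int -> R) M : (forall n, `|x n| <= M) -> supnorm x <= M.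
Proof.
move=> xM; apply: ge_sup; first by exists `|x 0|, 0.
by move=> _ [n _ <-].
Qed.

Lemma ellinf_norm_ge0 (x : ellinf) : 0 <= ellinf_norm x.
Proof. exact: le_trans (ellinf_norm_ub x 0). Qed.

Lemma ellinf_normD (x y : ellinf) :
  ellinf_norm (x + y) <= ellinf_norm x + ellinf_norm y.
Proof.
apply: supnorm_le => n; rewrite -[(x + y) n]/(x n + y n).
by rewrite (le_trans (ler_normD _ _))// lerD// ellinf_norm_ub.
Qed.

Lemma ellinf_normZ_le a (x : ellinf) :
  ellinf_norm (a *: x) <= `|a| * ellinf_norm x.
Proof.
apply: supnorm_le => n; rewrite -[(a *: x) n]/(a * x n) normrM.
by rewrite ler_wpM2l// ellinf_norm_ub.
Qed.

Lemma ellinf_normZ a (x : ellinf) :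
  ellinf_norm (a *: x) = `|a| * ellinf_norm x.
Proof.
apply/eqP; rewrite eq_le ellinf_normZ_le/=.
have [->|a0] := eqVneq a 0; first by rewrite normr0 mul0r ellinf_norm_ge0.
rewrite -ler_pdivlMl ?normr_gt0// -normfV.
by rewrite (le_trans _ (ellinf_normZ_le _ _))// scalerA mulVf// scale1r.
Qed.

Lemma ellinf_norm_eq0 (x : ellinf) : ellinf_norm x = 0 -> x = 0.
Proof.
move=> x0; apply/val_inj/funext => n; apply/eqP; rewrite -normr_le0.
by rewrite (le_trans (ellinf_norm_ub x n))// x0.
Qed.

HB.instance Definition _ :=
  Lmodule_isNormed.Build R ellinf ellinf_normD ellinf_normZ ellinf_norm_eq0.

Lemma ellinf_normE (x : ellinf) : `|x| = sup (range (fun n => `|x n|)).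
Proof. by []. Qed.

Lemma bounded_seq_translate (d : int) (x : ellinf) :
  bounded_seq (fun n => x (n + d)).
Proof.
by apply/bounded_seqE; exists (ellinf_norm x) => n; exact: ellinf_norm_ub.
Qed.

Lemma translateinf_subproof (d : int) :
  bounded_operator (fun x : ellinf => mk_ellinf (bounded_seq_translate d x)).
Proof.
split; first by move=> a x y; exact: val_inj.
by exists 1 => x; rewrite mul1r supnorm_le// => n; exact: (ellinf_norm_ub x (n + d)).
Qed.

Definition Uinf : bop ellinf := mk_bop (translateinf_subproof (-1)).
Definition UinfV : bop ellinf := mk_bop (translateinf_subproof 1).
Definition Ainf : bop ellinf := Uinf + UinfV - (2 : R) *: bop_id.

Lemma AinfE (x : ellinf) n : Ainf x n = x (n + 1) + x (n - 1) - 2 * x n.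
Proof. by rewrite [x (n + 1) + _]addrC. Qed.

End EllInf.

(* Main.v *)
From HB Require Import structures.
Require Import Defs.
From mathcomp Require Import all_boot all_order all_algebra.
From mathcomp Require Import all_classical all_reals all_analysis.
From mathcomp Require Import finmap ring lra.
Set Implicit Arguments.
Unset Strict Implicit.
Unset Printing Implicit Defensive.
Import Order.TTheory GRing.Theory Num.Theory.
Import numFieldNormedType.Exports.
Local Open Scope classical_set_scope.
Local Open Scope ring_scope.

(** Write [A = U + U^-1 - 2 = 2 (T - 1)] with [T = (U + U^-1) / 2].  On both
    spaces the shifts are isometries, so [T] is a contraction, and two facts
    about contractions give everything that is common to the two spaces:
    [e^{s(T-1)} = e^{-s} e^{sT}] has norm at most 1, and
    [(T - 1) e^{s(T-1)}] has norm at most [1/sqrt s] ([norm_sub1_bexp]).  For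
    the latter, summation by parts turns
    [e^{-s} sum_k s^k/k! (T^{k+1} - T^k)] into
    [e^{-s} sum_k (k/s - 1) s^k/k! T^k], whose norm is at most [E|K/s - 1|] for a
    Poisson variable [K] of mean [s]; this is at most the standard deviation
    [1/sqrt s] of [K/s].  Hence [A e^{At}] tends to 0 in operator norm, which
    settles the derivative and the range of [A] on l^oo.

    The link between the equation and the exponential is a product rule: if
    [p' = A p] and [B] commutes with [A], then [e^{Bt} p(t)] solves the
    equation of [A + B] ([solves_bexp_app]).  Taking [B = - A] gives a function
    with zero derivative, hence uniqueness of solutions ([solvesP]); uniqueness
    in turn gives [e^{(A+B)t} = e^{Bt} e^{At}].  Convergence of the exponential
    series rests on completeness of l^2, l^oo and their operator spaces.

    The norm of [e^{At}] is not smaller than 1: on l^oo the constant sequence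
    1 is fixed, and on l^2 the indicators of long intervals are almost fixed,
    because [A] sends the indicator of [n] consecutive integers, of norm
    [sqrt n], to a vector of norm at most 4.

    On l^2 every orbit even tends to 0 in norm ([bexp_A2_cvg0]), which implies
    both the uniform and the weak statement.  The set of initial data with
    vanishing orbit is a closed subspace containing the range of [A], that is
    the range of [(U - 1)^2].  The mean ergodic argument enlarges it twice:
    [x] lies in the closure of the range of [U - 1] as soon as its averages
    [(x + U x + .. + U^{n-1} x) / n] tend to 0.  For [x] in the range of
    [U - 1] these averages telescope, and for a unit vector they have norm
    [1/sqrt n]; unit vectors span a dense subspace. *)

(** * Completeness of the sequence and operator spaces *)

Section Completeness.
Context {R : realType}.

(** A coordinatewise (or pointwise) limit [l] of a Cauchy filter is easily seen
    to be within [e] of [x] as soon as almost all members of the filter are;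
    choosing [x] itself far along the filter turns this into convergence in
    norm. *)
Lemma complete_of_near_limit (V : normedModType R) :
  (forall F : set_system V, ProperFilter F -> cauchy F ->
     exists l : V, forall x e, (\forall y \near F, `|x - y| <= e) -> `|x - l| <= e) ->
  forall F : set_system V, ProperFilter F -> cauchy F -> cvg F.
Proof.
move=> VP F FF cF; have [l lP] := VP F FF cF.
apply/cvg_ex; exists l; apply/cvgrPdist_le => e e0.
have /cauchy_ballP/(_ e e0)/nearP_dep := cF.
apply: filterS => x xF; rewrite distrC; apply: lP.
by apply: filterS xF => y; rewrite -ball_normE => /ltW.
Qed.

(** Provides the limits of the coordinates, or of the values at a point. *)
Lemma cauchy_lipschitz (V : normedModType R) (W : completeNormedModType R)
    (f : V -> W) (C : R) (F : set_system V) :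
  ProperFilter F -> cauchy F -> (forall x y, `|f x - f y| <= C * `|x - y|) ->
  exists l : W, f @ F --> l.
Proof.
move=> FF cF fC; apply/cvg_ex/cauchy_cvgP/cauchy_ballP => e e0.
have C1 : 0 < `|C| + 1 by rewrite ltr_wpDl.
have /cauchy_ballP/(_ (e / (`|C| + 1))) := cF; rewrite divr_gt0// => /(_ isT) H.
rewrite near_map2; apply: filterS H => -[x y] /=; rewrite -!ball_normE /= => xy.
rewrite (le_lt_trans (fC x y))//.
rewrite ltr_pdivlMr// mulrC in xy; apply: le_lt_trans xy.
by rewrite ler_wpM2r// (le_trans (ler_norm C))// lerDl.
Qed.

Lemma ellinf_complete (F : set_system (ellinf R)) :
  ProperFilter F -> cauchy F -> cvg F.
Proof.
apply: complete_of_near_limit => {}F FF cF.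
have coord n : exists l : R, (fun x : ellinf R => x n) @ F --> l.
  apply: (@cauchy_lipschitz _ _ (fun x : ellinf R => x n) 1 F FF cF) => x y.
  by rewrite mul1r; exact: (ellinf_norm_ub (x - y)).
have [l lP] := choice coord.
have near_l (x : ellinf R) e : (\forall y \near F, `|x - y| <= e) ->
    forall n, `|x n - l n| <= e.
  move=> xF n; apply: (@cvgr_to_le _ F _ R (fun y : ellinf R => `|x n - y n|)).
    by apply: cvg_norm; apply: cvgB; [exact: cvg_cst|exact: lP].
  apply: filterS xF => y; apply: le_trans; exact: (ellinf_norm_ub (x - y)).
have lb : bounded_seq l.
  have /cauchy_ballP/(_ 1 ltr01)/nearP_dep/filter_ex[x xF] := cF.
  apply/bounded_seqE; exists (ellinf_norm x + 1) => n.
  rewrite -[l n](subrK (x n)) (le_trans (ler_normD _ _))// addrC lerD//.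
    exact: ellinf_norm_ub.
  rewrite distrC; apply: near_l.
  by apply: filterS xF => y; rewrite -ball_normE => /ltW.
by exists (mk_ellinf lb) => x e /near_l xl; apply: supnorm_le.
Qed.

HB.instance Definition _ := Uniform_isComplete.Build (ellinf R) ellinf_complete.

Lemma ell2_complete (F : set_system (ell2 R)) :
  ProperFilter F -> cauchy F -> cvg F.
Proof.
apply: complete_of_near_limit => {}F FF cF.
have coord n : exists l : R, (fun x : ell2 R => x n) @ F --> l.
  apply: (@cauchy_lipschitz _ _ (fun x : ell2 R => x n) 1 F FF cF) => x y.
  by rewrite mul1r; exact: (coord_le_l2 n (ell2P (x - y))).
have [l lP] := choice coord.
have near_l (x : ell2 R) e : (\forall y \near F, `|x - y| <= e) ->
    forall G : {fset int}, \sum_(n <- G) (x n - l n) ^+ 2 <= e ^+ 2.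
  move=> xF G.
  apply: (@cvgr_to_le _ F _ R (fun y : ell2 R => \sum_(n <- G) (x n - y n) ^+ 2)).
    apply: cvg_big => [|n _]; first exact: add_continuous.
    rewrite expr2; under eq_fun do rewrite expr2.
    by apply: cvgM; (apply: cvgB; [exact: cvg_cst|exact: lP]).
  apply: filterS xF => y xy.
  apply: (le_trans (sqnorm_fset (ell2P (x - y)) G)).
  rewrite -(sqr_sqrtr (dotzz_ge0 (x - y))) lerXn2r ?nnegrE ?sqrtr_ge0//.
  exact: le_trans xy.
have l2 : square_summable l.
  have /cauchy_ballP/(_ 1 ltr01)/nearP_dep/filter_ex[x xF] := cF.
  have xl : square_summable (fun n => x n - l n).
    apply/square_summableE; apply: (@le_lt_trans _ _ (1 ^+ 2)%:E); last exact: ltry.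
    apply: sqnorm_le; apply: near_l.
    by apply: filterS xF => y; rewrite -ball_normE => /ltW.
  have := square_summableZD (-1) xl (ell2P x).
  congr square_summable; apply/funext => n.
  by rewrite -[(_ + _) n]/(-1 * (x n - l n) + x n) mulN1r opprB subrK.
exists (mk_ell2 l2) => x e xF; have /filter_ex[y /(le_trans (normr_ge0 _)) e0] := xF.
rewrite ell2_normE -(ger0_norm e0) -sqrtr_sqr ler_wsqrtr//.
by apply: dotz_le (sqr_ge0 e); exact: near_l.
Qed.

HB.instance Definition _ := Uniform_isComplete.Build (ell2 R) ell2_complete.

Lemma bop_complete (V : completeNormedModType R) (F : set_system (@bop R V)) :
  ProperFilter F -> cauchy F -> cvg F.
Proof.
apply: complete_of_near_limit => {}F FF cF.
have point x : exists l : V, (fun A : bop V => A x) @ F --> l.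
  apply: (@cauchy_lipschitz _ _ (fun A : bop V => A x) `|x| F FF cF) => A B.
  by rewrite mulrC; exact: (le_opnorm (A - B)).
have [L LP] := choice point.
have near_L (A : bop V) e : (\forall B \near F, `|A - B| <= e) ->
    forall x, `|A x - L x| <= e * `|x|.
  move=> AF x; apply: (@cvgr_to_le _ F _ R (fun B : bop V => `|A x - B x|)).
    by apply: cvg_norm; apply: cvgB; [exact: cvg_cst|exact: LP].
  apply: filterS AF => B AB; apply: (le_trans (le_opnorm (A - B) x)).
  by rewrite ler_wpM2r.
have LB : bounded_operator L.
  split.
    move=> a x y.
    have LxP := LP (a *: x + y).
    have axyP : (fun A : bop V => A (a *: x + y)) @ F --> a *: L x + L y.
      under eq_cvg do rewrite linearP.
      by apply: cvgD; [apply: cvgZl_tmp|]; exact: LP.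
    exact: (norm_cvg_unique LxP axyP).
  have /cauchy_ballP/(_ 1 ltr01)/nearP_dep/filter_ex[A AF] := cF.
  exists (opnorm A + 1) => x.
  rewrite -[L x](subrK (A x)) (le_trans (ler_normD _ _))// addrC mulrDl lerD//.
    exact: le_opnorm.
  rewrite distrC; apply: near_L.
  by apply: filterS AF => y; rewrite -ball_normE => /ltW.
exists (mk_bop LB) => A e AF; apply: opnorm_le => x x1.
have /filter_ex[B /(le_trans (normr_ge0 _)) e0] := AF.
by apply: (le_trans (near_L A e AF x)); rewrite ler_piMr.
Qed.

HB.instance Definition _ (V : completeNormedModType R) :=
  Uniform_isComplete.Build (@bop R V) (@bop_complete V).

End Completeness.

(** * The operator exponential *)

Section Limits.
Context {R : realType}.

Lemma cvg0_norm_le {T : Type} {F : set_system T} {FF : Filter F}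
    (V : normedModType R) (f : T -> V) (g : T -> R) :
  (\forall t \near F, `|f t| <= g t) -> g @ F --> 0 -> f @ F --> 0.
Proof.
move=> fg g0; apply: norm_cvg0.
apply: (@squeeze_cvgr _ _ _ _ (cst 0) g) => //; last exact: cvg_cst.
by apply: filterS fg => t fgt; rewrite /= normr_ge0.
Qed.

Lemma norm_lim_le (V : normedModType R) (u : nat -> V) (v : nat -> R) l c :
  u @ \oo --> l -> v @ \oo --> c -> (forall n, `|u n| <= v n) -> `|l| <= c.
Proof.
move=> ul vc uv; apply: (ler_cvg_to (cvg_norm ul) vc).
by apply: nearW => n; exact: uv.
Qed.

Lemma cvg_series_exp_coeff (x : R) : series (exp_coeff x) @ \oo --> expR x.
Proof. exact: is_cvg_series_exp_coeff. Qed.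

End Limits.
Arguments cvg_series_exp_coeff {R} x.

Section OperatorAlgebra.
Context {R : realType} {V : normedModType R}.
Implicit Types A B : @bop R V.

Lemma bopM A B x : (A * B) x = A (B x). Proof. by []. Qed.

Lemma bop_sumE (I : Type) (r : seq I) (F : I -> @bop R V) x :
  (\sum_(i <- r) F i) x = \sum_(i <- r) F i x.
Proof. by elim/big_rec2: _ => // i y B _ <-. Qed.

Lemma bop_scaleAl a A B : (a *: A) * B = a *: (A * B).
Proof. exact: bop_ext. Qed.

Lemma bop_scaleAr a A B : A * (a *: B) = a *: (A * B).
Proof. by apply: bop_ext => x; exact: linearZ. Qed.

Lemma norm_bop_le A M : 0 <= M -> (forall x, `|A x| <= M * `|x|) -> `|A| <= M.
Proof.
by move=> M0 AM; apply: opnorm_le => x x1; rewrite (le_trans (AM x))// ler_piMr.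
Qed.

Lemma norm_bopM A B : `|A * B| <= `|A| * `|B|.
Proof.
apply: norm_bop_le => [|x]; first exact: mulr_ge0.
rewrite bopM (le_trans (le_opnorm _ _))// -mulrA; apply: ler_wpM2l => //.
  exact: opnorm_ge0.
exact: le_opnorm.
Qed.

Lemma norm_bop1 : `|1 : @bop R V| <= 1.
Proof. by apply: norm_bop_le => // x; rewrite mul1r. Qed.

Lemma norm_bopX A k : `|A ^+ k| <= `|A| ^+ k.
Proof.
elim: k => [|k IH]; first by rewrite !expr0 norm_bop1.
by rewrite !exprS (le_trans (norm_bopM _ _))// ler_wpM2l.
Qed.

(** Evaluation is jointly continuous, by
    [f v - A x = f (v - x) + (f - A) x]. *)
Lemma cvg_bop_app {T : Type} {F : set_system T} {FF : Filter F}
    (f : T -> @bop R V) (v : T -> V) A x :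
  f @ F --> A -> v @ F --> x -> f t (v t) @[t --> F] --> A x.
Proof.
move=> fA vx; apply/subr_cvg0.
apply: (@cvg0_norm_le R _ _ _ _ _ (fun t => `|f t| * `|v t - x| + `|f t - A| * `|x|)).
  apply: nearW => t.
  rewrite -[X in `|X|](_ : f t (v t - x) + (f t - A) x = _).
    by rewrite (le_trans (ler_normD _ _))//; apply: lerD; exact: le_opnorm.
  by rewrite linearB bopD bopN addrA subrK.
rewrite -[0](_ : `|A| * 0 + 0 * `|x| = 0); last by rewrite mulr0 mul0r addr0.
apply: cvgD; apply: cvgM.
- exact: cvg_norm.
- by rewrite -(normr0 V) -(subrr x); apply: cvg_norm;
  apply: cvgB => //; exact: cvg_cst.
- by rewrite -(normr0 (@bop R V)) -(subrr A); apply: cvg_norm;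
  apply: cvgB => //; exact: cvg_cst.
- exact: cvg_cst.
Qed.

Lemma cvg_bopMl {T : Type} {F : set_system T} {FF : Filter F}
    (f : T -> @bop R V) A B : f @ F --> A -> B * f t @[t --> F] --> B * A.
Proof.
move=> fA; apply/subr_cvg0.
apply: (@cvg0_norm_le R _ _ _ _ _ (fun t => `|B| * `|f t - A|)).
  by apply: nearW => t; rewrite -[_ - _](mulrBr B) norm_bopM.
rewrite -[0](mulr0 `|B|); apply: cvgM; first exact: cvg_cst.
by rewrite -(normr0 (@bop R V)) -(subrr A); apply: cvg_norm;
  apply: cvgB => //; exact: cvg_cst.
Qed.

Lemma cvg_bopMr {T : Type} {F : set_system T} {FF : Filter F}
    (f : T -> @bop R V) A B : f @ F --> A -> f t * B @[t --> F] --> A * B.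
Proof.
move=> fA; apply/subr_cvg0.
apply: (@cvg0_norm_le R _ _ _ _ _ (fun t => `|f t - A| * `|B|)).
  by apply: nearW => t; rewrite -[_ - _](mulrBl B) norm_bopM.
rewrite -[0](mul0r `|B|); apply: cvgM; last exact: cvg_cst.
by rewrite -(normr0 (@bop R V)) -(subrr A); apply: cvg_norm;
  apply: cvgB => //; exact: cvg_cst.
Qed.

End OperatorAlgebra.

Section OperatorExponential.
Context {R : realType} {V : completeNormedModType R}.
Implicit Types (A B : @bop R V) (t s h : R).

Definition bexp_psum A t (n : nat) : @bop R V :=
  series (fun k : nat => (t ^+ k / k`!%:R) *: A ^+ k) n.

Lemma bexp_psumE A t n :
  bexp_psum A t n = \sum_(0 <= k < n) (t ^+ k / k`!%:R) *: A ^+ k.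
Proof. by []. Qed.

Lemma norm_exp_term A t k :
  `|(t ^+ k / k`!%:R) *: A ^+ k| <= exp_coeff (`|t| * `|A|) k.
Proof.
rewrite normrZ /exp_coeff/= normrM normrX normfV normr_nat exprMn mulrAC.
by rewrite ler_wpM2r// ler_wpM2l ?exprn_ge0// norm_bopX.
Qed.

Lemma cvg_bexp_psum A t : bexp_psum A t @ \oo --> bexp A t.
Proof.
suff : cvgn (bexp_psum A t) by [].
apply: normed_cvg; apply: series_le_cvg (is_cvg_series_exp_coeff (`|t| * `|A|)).
- by move=> n; exact: normr_ge0.
- by move=> n; rewrite exp_coeff_ge0// mulr_ge0.
- by move=> n; exact: norm_exp_term.
Qed.

Arguments cvg_bexp_psum : clear implicits.

Lemma norm_bexp A t : `|bexp A t| <= expR (`|t| * `|A|).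
Proof.
apply: (norm_lim_le (cvg_bexp_psum A t) (cvg_series_exp_coeff (`|t| * `|A|))) => n.
rewrite (le_trans (ler_norm_sum _ _ _))//.
by apply: ler_sum => k _; exact: norm_exp_term.
Qed.

Lemma bexp0 A : bexp A 0 = 1.
Proof.
apply: (@norm_cvg_unique _ _ _ _ _ _ (cvg_bexp_psum A 0)).
rewrite /= -(cvg_shiftS (bexp_psum A 0)); under eq_cvg => n.
  rewrite /bexp_psum seriesEnat /= big_nat_recl// big1 => [|k _]; last first.
    by rewrite expr0n/= mul0r scale0r.
  rewrite addr0 !expr0 fact0 divr1 scale1r.
  over.
exact: cvg_cst.
Qed.

Lemma bexp_comm A B t : B * A = A * B -> B * bexp A t = bexp A t * B.
Proof.
move=> BA; apply: (norm_cvg_unique (cvg_bopMl (B := B) (cvg_bexp_psum A t))); rewrite /=.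
under eq_cvg => n.
  rewrite (_ : B * bexp_psum A t n = bexp_psum A t n * B); first over.
  rewrite bexp_psumE mulr_sumr mulr_suml; apply: eq_bigr => k _.
  by rewrite bop_scaleAl bop_scaleAr (commrX k (BA : GRing.comm B A)).
exact: cvg_bopMr (cvg_bexp_psum A t).
Qed.

Lemma bexp_scalar (c t : R) : bexp (c *: (1 : @bop R V)) t = expR (t * c) *: (1 : @bop R V).
Proof.
apply: (@norm_cvg_unique _ _ _ _ _ _ (cvg_bexp_psum (c *: (1 : @bop R V)) t)); rewrite /=.
under eq_cvg => n.
  rewrite (_ : bexp_psum _ t n = series (exp_coeff (t * c)) n *: (1 : @bop R V)); first over.
  rewrite bexp_psumE scaler_suml; apply: eq_bigr => k _.
  rewrite /exp_coeff /= (_ : (c *: (1 : @bop R V)) ^+ k = c ^+ k *: (1 : @bop R V)).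
    by rewrite scalerA exprMn mulrAC.
  elim: k => [|k IH]; first by rewrite !expr0 scale1r.
  by rewrite !exprS IH bop_scaleAl bop_scaleAr mulr1 scalerA.
by apply: cvgZr_tmp; exact: cvg_series_exp_coeff.
Qed.

Lemma bexpZ (c : R) A t : bexp (c *: A) t = bexp A (t * c).
Proof.
rewrite /bexp; congr (lim (series _ @ \oo)); apply/funext => k.
rewrite (_ : (c *: A) ^+ k = c ^+ k *: A ^+ k).
  by rewrite scalerA exprMn mulrAC.
elim: k => [|k IH]; first by rewrite !expr0 scale1r.
by rewrite !exprS IH bop_scaleAl bop_scaleAr scalerA.
Qed.

(** Crude bounds with [1 + |t|] in place of the exact binomial constants: what
    matters is that the bounds are again [k]-th powers, so that the remainder
    of the exponential series is dominated by an exponential. *)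
Lemma exprD_sub_le t h k : `|h| <= 1 ->
  `|(t + h) ^+ k - t ^+ k| <= `|h| * (1 + `|t|) ^+ k.
Proof.
move=> h1; elim: k => [|k IH]; first by rewrite !expr0 subrr normr0 mulr1.
rewrite (_ : _ - _ = t * ((t + h) ^+ k - t ^+ k) + h * (t + h) ^+ k); last first.
  by rewrite !exprS; ring.
rewrite (le_trans (ler_normD _ _))// !normrM.
rewrite (_ : `|h| * _ =
  `|t| * (`|h| * (1 + `|t|) ^+ k) + `|h| * (1 + `|t|) ^+ k); last by rewrite exprS; ring.
rewrite lerD ?ler_wpM2l// normrX lerXn2r ?nnegrE ?addr_ge0//.
by rewrite (le_trans (ler_normD _ _))// addrC lerD2r.
Qed.

Lemma exprD_taylor_le t h k : `|h| <= 1 ->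
  `|(t + h) ^+ k.+1 - t ^+ k.+1 - h * (k.+1%:R * t ^+ k)| <=
  h ^+ 2 * (1 + `|t|) ^+ k.+1.
Proof.
move=> h1; elim: k => [|k IH].
  rewrite !expr1 expr0 mulr1 mulr1 (_ : _ - _ = 0) ?normr0; last by ring.
  by rewrite mulr_ge0 ?sqr_ge0// addr_ge0.
set d := (X in `|X| <= _) in IH.
rewrite [X in `|X|](_ : _ = t * d + h * ((t + h) ^+ k.+1 - t ^+ k.+1)); last first.
  by rewrite /d !exprS -[k.+2%:R]natr1; ring.
rewrite (le_trans (ler_normD _ _))// !normrM.
rewrite [leRHS](_ : _ = `|t| * (h ^+ 2 * (1 + `|t|) ^+ k.+1) +
    `|h| * (`|h| * (1 + `|t|) ^+ k.+1)); last first.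
  by rewrite -(real_normK (num_real h)) (exprS _ k.+1); ring.
by rewrite lerD// ler_wpM2l// exprD_sub_le.
Qed.

(** The derivative of the term of index [k+1] of the series is [A] times the
    term of index [k].  Comparing [n+1] terms of [e^{A(t+h)} - e^{At}] with [n]
    terms of [A e^{At}] therefore makes the remainder a termwise estimate. *)
Lemma bexp_taylor_le A t h : `|h| <= 1 ->
  `|bexp A (t + h) - bexp A t - h *: (A * bexp A t)| <=
  h ^+ 2 * expR ((1 + `|t|) * `|A|).
Proof.
move=> h1.
pose u n := bexp_psum A (t + h) n.+1 - bexp_psum A t n.+1
            - h *: (A * bexp_psum A t n).
pose v n := h ^+ 2 * series (exp_coeff ((1 + `|t|) * `|A|)) n.+1.
have cS s : bexp_psum A s n.+1 @[n --> \oo] --> bexp A s.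
  by rewrite (cvg_shiftS (bexp_psum A s)); exact: cvg_bexp_psum.
apply: (@norm_lim_le _ _ u v).
- apply: cvgB; first exact: cvgB.
  by apply: cvgZl_tmp; apply: cvg_bopMl; exact: cvg_bexp_psum.
- apply: cvgMl_tmp.
  rewrite (cvg_shiftS (series (exp_coeff ((1 + `|t|) * `|A|)))).
  exact: cvg_series_exp_coeff.
move=> n; rewrite /u /v.
rewrite !bexp_psumE mulr_sumr scaler_sumr -sumrB.
rewrite big_nat_recl// !expr0 subrr add0r -sumrB.
rewrite (le_trans (ler_norm_sum _ _ _))//.
rewrite seriesEnat /= [X in _ * X]big_nat_recl// mulrDr mulr_sumr.
rewrite -[leLHS]add0r lerD//.
  by rewrite mulr_ge0 ?sqr_ge0// exp_coeff_ge0// mulr_ge0// addr_ge0.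
apply: ler_sum => k _.
rewrite bop_scaleAr -exprS scalerA -2!scalerBl normrZ /exp_coeff /=.
rewrite (_ : _ - _ = ((t + h) ^+ k.+1 - t ^+ k.+1 - h * (k.+1%:R * t ^+ k))
   / (k.+1)`!%:R); last first.
  have k0 : k`!%:R != 0 :> R by rewrite pnatr_eq0 -lt0n fact_gt0.
  by rewrite factS natrM; field; rewrite k0 nat1r pnatr_eq0.
rewrite normrM normfV normr_nat exprMn.
rewrite [leRHS](_ : _ = h ^+ 2 * (1 + `|t|) ^+ k.+1 / (k.+1)`!%:R * `|A| ^+ k.+1);
  last by ring.
rewrite ler_pM// ?norm_bopX// ?mulr_ge0//.
by rewrite ler_wpM2r// exprD_taylor_le.
Qed.

Lemma bexp_derive A t :
  h^-1 *: (bexp A (t + h) - bexp A t) @[h --> 0^'] --> A * bexp A t.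
Proof.
apply/subr_cvg0.
apply: (@cvg0_norm_le R _ _ _ _ _ (fun h => `|h| * expR ((1 + `|t|) * `|A|))).
  have := @dnbhs0_le _ R^o _ ltr01; move=> h1; near=> h.
  have h0 : h != 0 by near: h; exact: nbhs_dnbhs_neq.
  rewrite -[_ - _](_ : h^-1 *: (bexp A (t + h) - bexp A t - h *: (A * bexp A t)) = _).
    rewrite normrZ normfV ler_pdivrMl ?normr_gt0// mulrA -expr2 real_normK ?num_real//.
    by rewrite bexp_taylor_le//; near: h.
  by rewrite scalerBr scalerA mulVf// scale1r.
have : `|h| * expR ((1 + `|t|) * `|A|) @[h --> (0 : R)^'] -->
    `|0 : R| * expR ((1 + `|t|) * `|A|).
  by apply: cvgM; [apply: cvg_norm; exact: cvg_within|exact: cvg_cst].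
by rewrite normr0 mul0r.
Unshelve. all: by end_near. Qed.

Lemma bexp_continuous A t : bexp A (t + h) @[h --> 0^'] --> bexp A t.
Proof.
have /cvgD : h *: (h^-1 *: (bexp A (t + h) - bexp A t)) @[h --> 0^'] -->
    (0 : R) *: (A * bexp A t).
  by apply: cvgZ (@bexp_derive A t); exact: cvg_within.
move=> /(_ _ _ (cvg_cst (bexp A t))); rewrite scale0r add0r.
apply: cvg_trans; apply: near_eq_cvg; near=> h.
have h0 : h != 0 by near: h; exact: nbhs_dnbhs_neq.
by rewrite -[LHS]/(_ *: (_ *: _) + bexp A t) scalerA mulfV// scale1r subrK.
Unshelve. all: by end_near. Qed.

End OperatorExponential.
Arguments cvg_bexp_psum {R V} A t.
Arguments bexp_derive {R V} A t.
Arguments bexp_continuous {R V} A t.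

(** * The Cauchy problem *)

Section CauchyProblem.
Context {R : realType} {V : completeNormedModType R}.
Implicit Types (A B : @bop R V) (t s h : R) (p : R -> V).

Lemma cvg_within_dnbhs {T : Type} {G : set_system T} (f : R -> T) (D : set R) :
  f @ (0 : R)^' `=>` G -> f @ within D (0 : R)^' `=>` G.
Proof. by move=> fG S /fG; exact: cvg_within. Qed.

Lemma solves_cst (x : V) : solves 0 (fun=> x).
Proof.
move=> t _; under eq_cvg do rewrite subrr scaler0.
exact: cvg_cst.
Qed.

(** The product rule.  All identities between exponentials below are obtained
    from it by choosing [B], through uniqueness of solutions. *)
Lemma solves_bexp_app A B p : A * B = B * A ->
  solves A p -> solves (A + B) (fun t => bexp B t (p t)).
Proof.
move=> AB pA t t0; set D := [set h | 0 <= t + h].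
rewrite bopD.
have := @bexp_comm R V B A t AB => /(congr1 (fun X : bop V => X (p t))).
rewrite !bopM => ->.
have step : bexp B (t + h) (h^-1 *: (p (t + h) - p t)) +
    (h^-1 *: (bexp B (t + h) - bexp B t)) (p t)
    @[h --> within D (0 : R)^'] --> bexp B t (A (p t)) + (B * bexp B t) (p t).
  apply: cvgD; apply: cvg_bop_app.
  - by apply: cvg_within_dnbhs; exact: bexp_continuous.
  - exact: pA.
  - by apply: cvg_within_dnbhs; exact: bexp_derive.
  - exact: cvg_cst.
apply: cvg_trans step; apply: near_eq_cvg; apply: nearW => h.
rewrite linearZ bopZ -scalerDr linearB bopD bopN; congr (_ *: _).
by rewrite addrA subrK.
Qed.

(** The mean value theorem is about real functions, but the difference
    quotients of [g s = |p s - p 0|] are dominated by those of [p], so [g] also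
    has derivative zero.  Replacing [s] by [max s 0] makes the one-sided
    derivative at 0 two-sided. *)
Lemma solves0_cst p t : solves 0 p -> 0 <= t -> p t = p 0.
Proof.
move=> p0 t0.
pose g s : R := `|p (Num.max s 0) - p 0|.
suff gcst : g t = g 0.
  move: gcst; rewrite /g maxxx subrr normr0 max_l// => /normr0_eq0/eqP.
  by rewrite subr_eq0 => /eqP.
apply: is_derive_0_is_cst => {t0}t.
suff dg : h^-1 *: ((g \o shift t) (h *: (1 : R)) - g t) @[h --> (0 : R)^'] --> (0 : R).
  by apply: DeriveDef; [apply/cvg_ex; exists 0|exact: norm_cvg_lim].
apply/cvgr0Pnorm_lt => e e0.
have hlt d : 0 < d -> \forall h \near (0 : R)^', `|h| < d.
  exact: (@dnbhs0_lt R R).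
have [t0|t0] := ltP t 0.
  near=> h.
  have ht : `|h| < - t by near: h; apply: hlt; rewrite oppr_gt0.
  rewrite /g /= [h *: 1]mulr1 (max_r (ltW t0)) max_r ?subrr ?normr0 ?subrr ?scaler0 ?normr0//.
  by rewrite -lerBrDr sub0r (le_trans (ler_norm _))// ltW.
have near0 : \forall h \near (0 : R)^', 0 <= t + h ->
    `|h^-1 *: (p (t + h) - p t)| < e.
  have := p0 t t0 => /cvgr0Pnorm_lt; exact.
move: t0; rewrite le_eqVlt => /orP[/eqP t0|t0].
  rewrite -t0 in near0 *.
  near=> h.
  rewrite /g /= [h *: 1]mulr1 maxxx subrr normr0 subr0 addr0.
  have [h0|h0] := leP 0 h; last by rewrite subrr normr0 scaler0 normr0.
  rewrite normrZ normr_id -normrZ -[h in p h]add0r.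
  by move: h0; rewrite -[leRHS]add0r; near: h.
near=> h.
have th : 0 <= t + h.
  have ht : `|h| < t by near: h; exact: hlt.
  by rewrite -lerBlDl sub0r lerNl (le_trans (ler_norm _))// normrN ltW.
rewrite /g /= [h *: 1]mulr1 [h + t]addrC !max_l ?(ltW t0)//.
have : `|h^-1 *: (p (t + h) - p t)| < e by move: th; near: h.
apply: le_lt_trans; rewrite !normrZ ler_wpM2l//.
rewrite (_ : p (t + h) - p t = (p (t + h) - p 0) - (p t - p 0)).
  exact: ler_dist_dist.
by rewrite opprB addrA subrK.
Unshelve. all: by end_near. Qed.

Lemma bexpK A t : 0 <= t -> bexp A t * bexp (- A) t = 1.
Proof.
move=> t0; apply: bop_ext => x.
have sA : solves (- A) (fun t => bexp (- A) t x).
  rewrite -[X in solves X _]add0r.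
  apply: (solves_bexp_app (A := 0) (p := fun=> x)); last exact: solves_cst.
  by rewrite mul0r mulr0.
have : solves 0 (fun t => bexp A t (bexp (- A) t x)).
  by rewrite -(addNr A); apply: solves_bexp_app _ sA; rewrite mulrN mulNr.
by move=> /solves0_cst/(_ t0); rewrite !bexp0.
Qed.

Lemma solves_bexp A x : solves A (fun t => bexp A t x).
Proof.
rewrite -[X in solves X _]add0r.
  apply: (solves_bexp_app (A := 0) (p := fun=> x)); last exact: solves_cst.
by rewrite mul0r mulr0.
Qed.

(** If [p] is a solution then [e^{-At} p(t)] has derivative zero. *)
Lemma solvesP A p :
  solves A p <-> forall t, 0 <= t -> p t = bexp A t (p 0).
Proof.
split=> [pA t t0|pE t t0].
  have : solves 0 (fun t => bexp (- A) t (p t)).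
    by rewrite -(subrr A); apply: solves_bexp_app _ pA; rewrite mulrN mulNr.
  move=> /solves0_cst/(_ t0); rewrite bexp0 => /(congr1 (bexp A t)).
  by rewrite -bopM bexpK.
rewrite [p t]pE//; apply: cvg_trans (@solves_bexp A (p 0) t t0).
apply: near_eq_cvg; apply: (@filterS _ _ _ [set h | 0 <= t + h]).
  by move=> h /= th; rewrite -!pE.
exact: withinT.
Qed.

Lemma bexpD A B t : A * B = B * A -> 0 <= t ->
  bexp (A + B) t = bexp B t * bexp A t.
Proof.
move=> AB t0; apply: bop_ext => x.
have := solves_bexp_app AB (@solves_bexp A x) => /solvesP/(_ t t0).
by rewrite !bexp0 => <-.
Qed.

Lemma bexp_fixed A x t : A x = 0 -> 0 <= t -> bexp A t x = x.
Proof.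
move=> Ax t0; have : solves A (fun=> x).
  by move=> s s0; rewrite Ax; exact: (@solves_cst x s s0).
by move=> /solvesP/(_ t t0) <-.
Qed.

Lemma derive1_bexp A x t : derive1 (fun s => bexp A s x) t = A (bexp A t x).
Proof.
apply: norm_cvg_lim; rewrite -bopM.
under eq_cvg do rewrite [_ + t]addrC.
have := cvg_bop_app (bexp_derive A t) (cvg_cst x); exact.
Qed.

(** Every term of the series of [e^{At} x - x] contains the factor [A x], so an
    approximate null vector of [A] is almost fixed by [e^{At}].  Adding 1 to
    [|A|] allows bounding [|A|^k] by a power of exponent [k+1]. *)
Lemma bexp_sub_le A x t : `|bexp A t x - x| <= expR (`|t| * (1 + `|A|)) * `|A x|.
Proof.
pose u n := bexp_psum A t n.+1 x - x.
pose v n := series (exp_coeff (`|t| * (1 + `|A|))) n.+1 * `|A x|.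
apply: (@norm_lim_le _ _ u v).
- apply: cvgB; last exact: cvg_cst.
  apply: cvg_bop_app; last exact: cvg_cst.
  by rewrite (cvg_shiftS (bexp_psum A t)); exact: cvg_bexp_psum.
- apply: cvgMr_tmp.
  rewrite (cvg_shiftS (series (exp_coeff (`|t| * (1 + `|A|))))).
  exact: cvg_series_exp_coeff.
move=> n; rewrite /u /v bexp_psumE bop_sumE big_nat_recl// seriesEnat /=.
rewrite !expr0 fact0 divr1 scale1r addrAC subrr add0r.
rewrite (le_trans (ler_norm_sum _ _ _))//.
rewrite big_nat_recl// mulrDl -[leLHS]add0r lerD//.
  by rewrite mulr_ge0// exp_coeff_ge0// mulr_ge0// addr_ge0.
rewrite mulr_suml; apply: ler_sum => k _ /=.
rewrite [X in `|X|]bopZ (exprSr A) bopM normrZ /exp_coeff /= normrM normrX normfV normr_nat.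
rewrite [leRHS](_ : _ =
    `|t| ^+ k.+1 / (k.+1)`!%:R * ((1 + `|A|) ^+ k.+1 * `|A x|)); last first.
  by rewrite exprMn; ring.
rewrite ler_wpM2l ?divr_ge0 ?exprn_ge0//.
rewrite (le_trans (le_opnorm _ _))// ler_wpM2r//.
rewrite (le_trans (norm_bopX _ _))// (@le_trans _ _ ((1 + `|A|) ^+ k))//.
  by rewrite lerXn2r ?nnegrE ?addr_ge0// lerDr.
by rewrite exprSr ler_peMr ?exprn_ge0 ?addr_ge0// lerDl.
Qed.

End CauchyProblem.

(** * Generators built from a contraction *)

Section Contraction.
Context {R : realType} {V : completeNormedModType R}.
Implicit Types (T : @bop R V) (s t c : R).

Lemma bexp_sub1 T s : 0 <= s -> bexp (T - 1) s = expR (- s) *: bexp T s.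
Proof.
move=> s0; rewrite -scaleN1r bexpD//; last by rewrite bop_scaleAr bop_scaleAl mulr1 mul1r.
by rewrite bexp_scalar mulrN1 bop_scaleAl mul1r.
Qed.

(** The factor [e^{-s}] produced by [-1] exactly compensates the bound
    [e^{s|T|}] of the exponential of [s T]. *)
Lemma norm_bexp_contraction T s : `|T| <= 1 -> 0 <= s -> `|bexp (T - 1) s| <= 1.
Proof.
move=> T1 s0; rewrite bexp_sub1// normrZ ger0_norm ?expR_ge0// -(expR0 R).
rewrite -(addNr s) expRD ler_wpM2l ?expR_ge0// (le_trans (norm_bexp _ _))//.
by rewrite ler_expR ger0_norm// ler_piMr.
Qed.

Lemma exp_coeffS s k : s != 0 ->
  k.+1%:R / s * exp_coeff s k.+1 = exp_coeff s k.
Proof.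
move=> s0; rewrite /exp_coeff /= factS natrM exprS.
have k0 : k`!%:R != 0 :> R by rewrite pnatr_eq0 -lt0n fact_gt0.
by field; rewrite k0 s0 nat1r pnatr_eq0.
Qed.

(** Summation by parts, with the difference of two consecutive coefficients
    [a_{k-1} - a_k] of the exponential series written as [(k/s - 1) a_k]; the
    last term is the boundary term. *)
Lemma sub1_bexp_psum T s n : s != 0 ->
  (T - 1) * bexp_psum T s n =
  \sum_(0 <= k < n) ((k%:R / s - 1) * exp_coeff s k) *: T ^+ k
  + (n%:R / s * exp_coeff s n) *: T ^+ n.
Proof.
move=> s0; elim: n => [|n IH].
  by rewrite bexp_psumE !big_nil mulr0 mul0r mul0r scale0r addr0.
rewrite bexp_psumE big_nat_recr//= -bexp_psumE mulrDr IH big_nat_recr//=.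
rewrite exp_coeffS// -!addrA; congr (_ + _).
rewrite bop_scaleAr mulrBl mul1r -exprS -/(exp_coeff s n).
rewrite mulrBl mul1r scalerBl scalerBr -/(exp_coeff s n).
by rewrite addrA addrAC.
Qed.

(** After multiplication by [e^{-s}] and as [n] grows this says that [K/s] has
    variance [1/s] when [K] is a Poisson variable of mean [s].  The truncated
    identity, with its boundary term, is proved by induction. *)
Lemma poisson_variance_psum s n : s != 0 ->
  \sum_(0 <= k < n) (k%:R / s - 1) ^+ 2 * exp_coeff s k =
  series (exp_coeff s) n / s + n%:R / s * exp_coeff s n * (1 - n%:R / s).
Proof.
move=> s0; elim: n => [|n IH].
  by rewrite seriesEnat /= !big_nil !mul0r addr0.
rewrite big_nat_recr//= IH seriesEnat /= big_nat_recr//= exp_coeffS//.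
by field; rewrite s0.
Qed.

(** The mean of [|K/s - 1|] is at most the standard deviation of [K/s]. *)
Lemma norm_sub1_bexp T s : `|T| <= 1 -> 0 < s ->
  `|(T - 1) * bexp (T - 1) s| <= (Num.sqrt s)^-1.
Proof.
move=> T1 s_gt0; have sN0 : s != 0 by rewrite gt_eqF.
rewrite bexp_sub1 ?(ltW s_gt0)// bop_scaleAr normrZ ger0_norm ?expR_ge0//.
rewrite expRN ler_pdivrMl ?expR_gt0//.
set r := Num.sqrt s; have r0 : 0 < r by rewrite sqrtr_gt0.
have sr : s = r ^+ 2 by rewrite sqr_sqrtr// ltW.
pose v n := series (exp_coeff s) n.+1 / r + (1 + r / 2) * exp_coeff s n.
rewrite [leRHS]mulrC.
have cE : series (exp_coeff s) n.+1 @[n --> \oo] --> expR s.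
  by rewrite (cvg_shiftS (series (exp_coeff s))); exact: cvg_series_exp_coeff.
apply: (@norm_lim_le _ _ (fun n => (T - 1) * bexp_psum T s n.+1) v).
- apply: cvg_bopMl.
  by rewrite (cvg_shiftS (bexp_psum T s)); exact: cvg_bexp_psum.
- rewrite mulrC -[X in _ --> X]addr0 -[X in _ --> _ + X](mulr0 (1 + r / 2)).
  apply: cvgD; first by apply: cvgM => //; exact: cvg_cst.
  by apply: cvgM; [exact: cvg_cst|exact: cvg_exp_coeff].
move=> n; rewrite sub1_bexp_psum//.
have an0 k : 0 <= exp_coeff s k by rewrite exp_coeff_ge0// ltW.
have TX k : `|T ^+ k| <= 1 by rewrite (le_trans (norm_bopX _ _))// exprn_ile1.
rewrite (le_trans (ler_normD _ _))//.
apply: (@le_trans _ _ (\sum_(0 <= k < n.+1)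
    (r^-1 / 2 * exp_coeff s k + r / 2 * ((k%:R / s - 1) ^+ 2 * exp_coeff s k))
    + exp_coeff s n)).
  apply: lerD; last first.
    by rewrite exp_coeffS// normrZ ger0_norm// ler_piMr.
  rewrite (le_trans (ler_norm_sum _ _ _))//; apply: ler_sum => k _.
  rewrite normrZ normrM (ger0_norm (an0 k)).
  apply: (@le_trans _ _ (`|k%:R / s - 1| * exp_coeff s k)).
    by rewrite ler_piMr// mulr_ge0.
  rewrite [leRHS](_ : _ =
      (r^-1 / 2 + r / 2 * (k%:R / s - 1) ^+ 2) * exp_coeff s k); last by ring.
  rewrite ler_wpM2r// -(real_normK (num_real (_ - 1))).
  set d := `|_|.
  (* AM-GM: [2 d <= 1/r + r d^2]. *)
  rewrite -subr_ge0 (_ : _ - _ = (1 - r * d) ^+ 2 / (2 * r)).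
    by rewrite divr_ge0 ?sqr_ge0// mulr_ge0// ltW.
  by field; rewrite gt_eqF.
rewrite big_split /= -!mulr_sumr poisson_variance_psum// exp_coeffS//.
rewrite /v seriesEnat /= -subr_ge0.
set E := \sum_(0 <= i < n.+1) _; set a := exp_coeff s n.
rewrite (_ : _ - _ = r / 2 * a * (n.+1%:R / s)).
  by apply: mulr_ge0; [apply: mulr_ge0 (an0 n); rewrite divr_ge0// ltW|rewrite divr_ge0// ltW].
by rewrite sr; field; rewrite gt_eqF.
Qed.

Lemma norm_generator_bexp T c t : `|T| <= 1 -> 0 < c -> 0 < t ->
  `|(c *: (T - 1)) * bexp (c *: (T - 1)) t| <= c / Num.sqrt (t * c).
Proof.
move=> T1 c0 t0; rewrite bexpZ bop_scaleAl normrZ gtr0_norm//.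
apply: ler_wpM2l; first exact: ltW.
by rewrite norm_sub1_bexp// mulr_gt0.
Qed.

Lemma cvg_generator_bexp T c : `|T| <= 1 -> 0 < c ->
  `|(c *: (T - 1)) * bexp (c *: (T - 1)) t| @[t --> +oo] --> (0 : R).
Proof.
move=> T1 c0; apply/cvgr0Pnorm_le => e e0.
near=> t.
have t0 : 0 < t by near: t; exact: nbhs_pinfty_gt.
have te : c / e ^+ 2 <= t by near: t; apply: nbhs_pinfty_ge; exact: num_real.
rewrite normr_id (le_trans (norm_generator_bexp T1 c0 t0))//.
rewrite ler_pdivrMr ?sqrtr_gt0 ?mulr_gt0// -ler_pdivrMl//.
rewrite -[leLHS]ger0_norm; last by rewrite mulr_ge0 ?invr_ge0 ?(ltW e0) ?(ltW c0).
rewrite -sqrtr_sqr ler_wsqrtr//.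
rewrite (_ : _ ^+ 2 = c / e ^+ 2 * c); last by field; rewrite gt_eqF.
by rewrite ler_wpM2r// ltW.
Unshelve. all: by end_near. Qed.

End Contraction.

(** * The discrete Laplacian and mean ergodic approximation *)

Section Laplacian.
Context {R : realType} {V : completeNormedModType R}.
Implicit Types (U W : @bop R V).

(** The average of two contractions is a contraction, so this brings the
    discrete Laplacian under the results on contractions. *)
Lemma laplacianE U W :
  U + W - (2 : R) *: (1 : @bop R V) = (2 : R) *: ((2^-1 : R) *: (U + W) - 1).
Proof. by rewrite scalerBr scalerA divff// scale1r. Qed.

Lemma norm_average U W : `|U| <= 1 -> `|W| <= 1 -> `|(2^-1 : R) *: (U + W)| <= 1.
Proof.
move=> U1 W1; rewrite normrZ ger0_norm// ler_pdivrMl// mulr1.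
by rewrite (le_trans (ler_normD _ _))// -[leRHS](natrD R 1 1) lerD.
Qed.

Lemma norm_bexp_laplacian U W t : `|U| <= 1 -> `|W| <= 1 -> 0 <= t ->
  `|bexp (U + W - (2 : R) *: (1 : @bop R V)) t| <= 1.
Proof.
move=> U1 W1 t0; rewrite laplacianE bexpZ.
by rewrite norm_bexp_contraction ?norm_average// mulr_ge0.
Qed.

Lemma cvg_laplacian_bexp U W : `|U| <= 1 -> `|W| <= 1 ->
  let A := U + W - (2 : R) *: (1 : @bop R V) in
  `|A * bexp A t| @[t --> +oo] --> (0 : R).
Proof.
move=> U1 W1; rewrite laplacianE.
by apply: cvg_generator_bexp (norm_average _ _) _.
Qed.

End Laplacian.

Section MeanErgodic.
Context {R : realType} {V : completeNormedModType R}.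
Implicit Types (U Y : @bop R V) (x z : V).

Lemma subX1_geometric U n : (U - 1) * \sum_(0 <= k < n) U ^+ k = U ^+ n - 1.
Proof. by rewrite big_mkord subrX1. Qed.

Lemma geometric_comm U n :
  U * (\sum_(0 <= k < n) U ^+ k) = (\sum_(0 <= k < n) U ^+ k) * U.
Proof.
by rewrite mulr_sumr mulr_suml; apply: eq_bigr => k _; rewrite -exprS -exprSr.
Qed.

(** The mean ergodic argument: [n - (1 + U + .. + U^{n-1})] is divisible by
    [U - 1], so [x] differs from an element of the range of [U - 1] by its
    average over [n] iterates.  The operator [Y] is a polynomial in [U], which
    is what its commutation with [U] records. *)
Lemma cesaro_approx U x :
  (forall e, 0 < e -> exists2 n, (0 < n)%N &
     `|(\sum_(0 <= k < n) U ^+ k) x| <= n%:R * e) ->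
  forall e, 0 < e -> exists2 Y, U * Y = Y * U & `|x - (U - 1) (Y x)| <= e.
Proof.
move=> smallV e /smallV[n n0 Vx].
pose G k := \sum_(0 <= i < k) U ^+ i.
(* [G] sums geometric progressions: [(U - 1) * sum_k G k = G n - n]. *)
pose Y := - (n%:R^-1 : R) *: \sum_(0 <= k < n) G k.
have nN0 : n%:R != 0 :> R by rewrite pnatr_eq0 -lt0n.
have UY : (U - 1) * \sum_(0 <= k < n) G k = G n - (n%:R : R) *: (1 : @bop R V).
  rewrite mulr_sumr; under eq_bigr do rewrite subX1_geometric.
  by rewrite sumrB; congr (_ - _); rewrite big_const_nat subn0 iter_addr_0 scaler_nat.
exists Y.
  rewrite /Y bop_scaleAl bop_scaleAr mulr_sumr mulr_suml; congr (_ *: _).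
  by apply: eq_bigr => k _; exact: geometric_comm.
rewrite -bopM /Y bop_scaleAr UY scaleNr bopN opprK bopZ bopD bopN bopZ.
rewrite scalerBr scalerA mulVf// scale1r addrC subrK normrZ normfV normr_nat.
by rewrite ler_pdivrMl// ltr0n.
Qed.

(** For uniformly bounded operators the vectors sent to 0 in the limit form a
    closed set. *)
Lemma cvg0_closure {T : Type} {F : set_system T} {FF : Filter F}
    (f : T -> @bop R V) x :
  (\forall t \near F, `|f t| <= 1) ->
  (forall e, 0 < e -> exists2 y, `|x - y| <= e & f t y @[t --> F] --> 0) ->
  f t x @[t --> F] --> 0.
Proof.
move=> f1 xy; apply/cvgr0Pnorm_le => e e0.
have e20 : 0 < e / 2 by rewrite divr_gt0.
have [y xye /cvgr0_norm_le/(_ _ e20) fy] := xy _ e20.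
near=> t.
rewrite -(subrK y x) linearD (le_trans (ler_normD _ _))// (splitr e) lerD//.
  rewrite (le_trans (le_opnorm _ _))// -[leRHS]mul1r ler_pM ?opnorm_ge0//.
  by near: t.
by near: t.
Unshelve. all: by end_near. Qed.

(** The averages of [(U - 1) x] telescope to [(U^n - 1) x / n], hence the range
    of [U - 1] lies in the closure of the range of [(U - 1)^2]. *)
Lemma cvg0_range_sub1 {T : Type} {F : set_system T} {FF : Filter F}
    (f : T -> @bop R V) U x : `|U| <= 1 ->
  (\forall t \near F, `|f t| <= 1) ->
  (forall z, f t ((U - 1) ((U - 1) z)) @[t --> F] --> 0) ->
  f t ((U - 1) x) @[t --> F] --> 0.
Proof.
move=> U1 f1 fU; apply: cvg0_closure => // e e0.
have [|Y UY Yx] := @cesaro_approx U ((U - 1) x) _ e e0.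
  move=> d d0; pose n := (Num.truncn (2 * `|x| / d)).+1; exists n => //.
  rewrite -bopM mulrBr mulr1 -geometric_comm -[X in _ - X]mul1r -mulrBl.
  rewrite subX1_geometric bopD bopN (le_trans (ler_normD _ _))// normrN.
  apply: (@le_trans _ _ (2 * `|x|)).
    rewrite mulr2n mulrDl !mul1r lerD// (le_trans (le_opnorm _ _))//.
    by rewrite ler_piMl// (le_trans (norm_bopX _ _))// exprn_ile1.
  by rewrite -ler_pdivrMr// ltW// truncnS_gt.
exists ((U - 1) (Y ((U - 1) x))) => //.
have -> : Y ((U - 1) x) = (U - 1) (Y x).
  by rewrite -!bopM mulrBr mulrBl mulr1 mul1r UY.
exact: fU.
Qed.

End MeanErgodic.

(** * The discrete Laplacian on l^2 *)

Section SequenceInequalities.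
Context {R : realType}.

Lemma ler_sum_fset (I : choiceType) (A B : {fset I}) (c : I -> R) :
  (A `<=` B)%fset -> (forall i, 0 <= c i) ->
  \sum_(i <- A) c i <= \sum_(i <- B) c i.
Proof.
move=> AB c0; pose d i := if i \in A then c i else 0.
rewrite (_ : \sum_(i <- A) c i = \sum_(i <- A) d i); last first.
  by apply: eq_big_seq => i iA; rewrite /d iA.
rewrite (big_fset_incl _ AB) => [|i _ /negbTE iA]; last by rewrite /d iA.
by apply: ler_sum => i _; rewrite /d; case: ifP.
Qed.

(** The sums of the positive and of the negative part both lie in [[0, M]], so
    their difference lies in [[-M, M]]. *)
Lemma zsum_le (u : int -> R) M :
  (forall F : {fset int}, \sum_(n <- F) `|u n| <= M) -> `|zsum u| <= M.
Proof.
move=> uM.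
have part (v : int -> R) : (forall n, 0 <= v n <= `|u n|) ->
    0 <= fine (\esum_(n in [set: int]) (v n)%:E) <= M.
  move=> v0.
  have e0 : (0 <= \esum_(n in [set: int]) (v n)%:E)%E.
    by apply: esum_ge0 => n _; rewrite lee_fin; case/andP: (v0 n).
  have eM : (\esum_(n in [set: int]) (v n)%:E <= M%:E)%E.
    apply: ge_ereal_sup => _ [A [finA _] <-].
    rewrite fsbig_finite// sumEFin lee_fin (le_trans _ (uM (fset_set A)))//.
    by apply: ler_sum => n _; case/andP: (v0 n).
  rewrite fine_ge0//= -lee_fin fineK// ge0_fin_numE//.
  exact: le_lt_trans (ltry M).
rewrite /zsum.
have -> : (fun n => ((EFin \o u)^\+ n)%E) = (fun n => (Num.max (u n) 0)%:E).
  by apply/funext => n; rewrite funeposE /= EFin_max.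
have -> : (fun n => ((EFin \o u)^\- n)%E) = (fun n => (Num.max (- u n) 0)%:E).
  by apply/funext => n; rewrite funenegE /= EFin_max.
have /andP[p0 pM] := part (fun n => Num.max (u n) 0)
  (fun n => ltac:(by rewrite le_max lexx orbT ge_max normr_ge0 ler_norm)).
have /andP[q0 qM] := part (fun n => Num.max (- u n) 0)
  (fun n => ltac:(by rewrite le_max lexx orbT ge_max normr_ge0 -normrN ler_norm)).
rewrite ler_norml; apply/andP; split.
  by rewrite -[leLHS]add0r lerB.
by rewrite -[leRHS]subr0 lerB.
Qed.

Lemma dotz_cauchy_schwarz (x y : ell2 R) : `|dotz x y| <= `|x| * `|y|.
Proof.
apply: zsum_le => F.
have [->|x0] := eqVneq x 0.
  by rewrite normr0 mul0r big1// => n _; rewrite -[(0 : ell2 R) n]/(0 : R) mul0r normr0.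
have [->|y0] := eqVneq y 0.
  by rewrite normr0 mulr0 big1// => n _; rewrite -[(0 : ell2 R) n]/(0 : R) mulr0 normr0.
have a0 : 0 < `|x| by rewrite normr_gt0.
have b0 : 0 < `|y| by rewrite normr_gt0.
have sqle (z : ell2 R) : \sum_(n <- F) z n ^+ 2 <= `|z| ^+ 2.
  by rewrite ell2_normE sqr_sqrtr ?dotzz_ge0// sqnorm_fset//; exact: ell2P.
move: (sqle x) (sqle y); set a := `|x| in a0 *; set b := `|y| in b0 *.
move=> xa yb.
(* AM-GM with weights balanced so that the total is exactly [a * b]. *)
apply: (@le_trans _ _ (\sum_(n <- F)
    (b / a / 2 * x n ^+ 2 + a / b / 2 * y n ^+ 2))).
  apply: ler_sum => n _; rewrite normrM.
  rewrite -(real_normK (num_real (x n))) -(real_normK (num_real (y n))).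
  set c := `|x n|; set d := `|y n|.
  rewrite -subr_ge0 (_ : _ - _ = (b * c - a * d) ^+ 2 / (2 * a * b)).
    by rewrite divr_ge0 ?sqr_ge0// !mulr_ge0// ltW.
  by field; rewrite !gt_eqF.
rewrite big_split /= -!mulr_sumr.
rewrite [leRHS](_ : _ = b / a / 2 * a ^+ 2 + a / b / 2 * b ^+ 2).
  by apply: lerD; apply: ler_wpM2l => //; rewrite !divr_ge0// ltW.
by field; rewrite !gt_eqF.
Qed.

Lemma supnorm_le_norm (x : ell2 R) : supnorm x <= `|x|.
Proof. by apply: supnorm_le => n; exact: coord_le_l2 (ell2P x). Qed.

Lemma supnorm_ge0 (x : ell2 R) : 0 <= supnorm x.
Proof.
apply: le_trans (normr_ge0 (x 0)) _; apply: ub_le_sup; last by exists 0.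
by exists `|x| => _ [n _ <-]; exact: coord_le_l2 (ell2P x).
Qed.

Lemma norm_U2 : `|U2 R| <= 1.
Proof.
apply: norm_bop_le => // x; rewrite mul1r ler_wsqrtr// dotz_le ?dotzz_ge0//.
exact: ell2_shift_le.
Qed.

Lemma norm_U2V : `|U2V R| <= 1.
Proof.
apply: norm_bop_le => // x; rewrite mul1r ler_wsqrtr// dotz_le ?dotzz_ge0//.
exact: ell2_shift_le.
Qed.

Lemma norm_Uinf : `|Uinf R| <= 1.
Proof.
apply: norm_bop_le => // x; rewrite mul1r supnorm_le// => n.
exact: (ellinf_norm_ub x).
Qed.

Lemma norm_UinfV : `|UinfV R| <= 1.
Proof.
apply: norm_bop_le => // x; rewrite mul1r supnorm_le// => n.
exact: (ellinf_norm_ub x).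
Qed.

End SequenceInequalities.

Section UnitVectors.
Context {R : realType}.

Lemma sum_fset_pick (F : {fset int}) (c : int -> R) j :
  \sum_(m <- F) c m * (j == m)%:R = if j \in F then c j else 0.
Proof.
case: ifP => [jF|/negbT jF].
  rewrite (big_fsetD1 j)//= eqxx mulr1 big1_fset ?addr0// => m.
  by rewrite !inE eq_sym => /andP[/negbTE -> _] _; rewrite mulr0.
rewrite big1_fset// => m mF _; case: eqP => [jm|_]; last by rewrite mulr0.
by rewrite jm mF in jF.
Qed.

Lemma square_summable_delta (m : int) :
  square_summable (fun n : int => (n == m)%:R : R).
Proof.
apply/square_summableE; apply: le_lt_trans (ltry (1 : R)).
apply: sqnorm_le => F.
under eq_bigr => n _ do rewrite expr2 -natrM mulnb andbb -[_%:R]mul1r eq_sym.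
by rewrite sum_fset_pick; case: ifP.
Qed.

Definition delta (m : int) : ell2 R := mk_ell2 (square_summable_delta m).

Lemma ell2_sumE (I : Type) (r : seq I) (x : I -> ell2 R) j :
  (\sum_(i <- r) x i) j = \sum_(i <- r) x i j.
Proof. by elim/big_rec2: _ => // i y z _ <-. Qed.

Lemma sum_deltaE (F : {fset int}) (c : int -> R) j :
  (\sum_(m <- F) c m *: delta m) j = if j \in F then c j else 0.
Proof. by rewrite ell2_sumE -sum_fset_pick. Qed.

Lemma norm_sum_delta (F : {fset int}) (c : int -> R) :
  `|\sum_(m <- F) c m *: delta m| = Num.sqrt (\sum_(m <- F) c m ^+ 2).
Proof.
rewrite ell2_normE; congr Num.sqrt; apply/eqP; rewrite eq_le; apply/andP; split.
  apply: dotz_le => [G|]; last by apply: sumr_ge0 => m _; exact: sqr_ge0.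
  rewrite (le_trans (ler_sum_fset (fsubsetUl G F) _))// => [i|]; first exact: sqr_ge0.
  rewrite -(big_fset_incl _ (fsubsetUr G F)) => [|i _ /negbTE iF].
    by rewrite le_eqVlt; apply/orP; left; apply/eqP/eq_big_seq => i iF; rewrite sum_deltaE iF.
  by rewrite sum_deltaE iF expr0n.
rewrite (le_trans _ (sqnorm_fset (ell2P _) F))// le_eqVlt; apply/orP; left.
by apply/eqP/eq_big_seq => i iF; rewrite sum_deltaE iF.
Qed.

(** A finite set [F] carrying all but [e^2] of the squared norm of [x] works:
    the error lives off [F]. *)
Lemma delta_dense (x : ell2 R) e : 0 < e ->
  exists F : {fset int}, `|x - \sum_(m <- F) x m *: delta m| <= e.
Proof.
move=> e0.
have [F xF] : exists F : {fset int}, dotz x x - e ^+ 2 < \sum_(m <- F) x m ^+ 2.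
  apply: contrapT => /forallNP H.
  have xF (F : {fset int}) : \sum_(m <- F) x m ^+ 2 <= dotz x x - e ^+ 2.
    by rewrite leNgt; apply/negP; exact: H.
  have : dotz x x <= dotz x x - e ^+ 2.
    by apply: dotz_le => //; have := xF fset0; rewrite big_seq_fset0.
  by rewrite leNgt ltrBlDr ltrDl exprn_gt0.
exists F; rewrite ell2_normE -(ger0_norm (ltW e0)) -sqrtr_sqr ler_wsqrtr//.
apply: dotz_le (sqr_ge0 e) => G.
set d := fun n : int => if n \in F then 0 else x n ^+ 2.
rewrite (eq_bigr d) => [|n _]; last first.
  rewrite -[X in X ^+ 2]/(x n - (\sum_(m <- F) x m *: delta m) n) sum_deltaE /d.
  by case: ifP; rewrite ?subrr ?expr0n// subr0.
rewrite -(lerD2l (\sum_(m <- F) x m ^+ 2)).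
apply: (@le_trans _ _ (dotz x x)); last by rewrite -lerBlDr ltW.
rewrite (le_trans _ (sqnorm_fset (ell2P x) (F `|` G)%fset))//.
rewrite (_ : \sum_(n <- (F `|` G)%fset) x n ^+ 2 =
    \sum_(n <- (F `|` G)%fset) ((if n \in F then x n ^+ 2 else 0) + d n)); last first.
  by apply: eq_bigr => n _; rewrite /d; case: ifP; rewrite ?addr0 ?add0r.
rewrite big_split /= lerD//.
  rewrite -(big_fset_incl _ (fsubsetUl F G)) => [|n _ /negbTE ->]//.
  by rewrite le_eqVlt; apply/orP; left; apply/eqP/eq_big_seq => n ->.
apply: ler_sum_fset (fsubsetUr F G) _ => n; rewrite /d.
by case: ifP => // _; exact: sqr_ge0.
Qed.

Lemma U2X_delta k m : (U2 R ^+ k) (delta m) = delta (m + k%:Z).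
Proof.
elim: k => [|k IH]; first by rewrite expr0 addr0.
rewrite exprS bopM IH; apply/val_inj/funext => n /=.
by rewrite -[in RHS]addn1 PoszD addrA subr_eq.
Qed.

(** The translates of a unit vector are orthogonal, hence the growth in
    [sqrt n] rather than [n]: averages of unit vectors tend to 0. *)
Lemma norm_sum_U2X_delta n m :
  `|(\sum_(0 <= k < n) U2 R ^+ k) (delta m)| = Num.sqrt n%:R.
Proof.
have -> : (\sum_(0 <= k < n) U2 R ^+ k) (delta m) =
    \sum_(j <- [fset (m + k%:Z)%R | k in iota 0 n]%fset) (1 : R) *: delta j.
  rewrite big_imfset/= => [|i j _ _ /addrI[]//]; rewrite undup_id ?iota_uniq//.
  rewrite bop_sumE /index_iota subn0; apply: eq_bigr => k _.
  by rewrite scale1r U2X_delta.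
rewrite norm_sum_delta; under eq_bigr do rewrite expr1n.
rewrite big_imfset/= => [|i j _ _ /addrI[]//]; rewrite undup_id ?iota_uniq//.
by rewrite big_const_seq count_predT size_iota iter_addr_0.
Qed.

End UnitVectors.

Section Ell2Laplacian.
Context {R : realType}.

Let A2l : A2 R = U2 R + U2V R - (2 : R) *: (1 : bop (ell2 R)).
Proof. by []. Qed.

Lemma U2K : U2 R * U2V R = 1.
Proof.
by apply: bop_ext => x; apply/val_inj/funext => n /=; rewrite subrK.
Qed.

Lemma U2VK : U2V R * U2 R = 1.
Proof.
by apply: bop_ext => x; apply/val_inj/funext => n /=; rewrite addrK.
Qed.

(** The Laplacian is a second difference: [A = U^-1 (U - 1)^2]. *)
Lemma U2_A2 : U2 R * A2 R = (U2 R - 1) * (U2 R - 1).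
Proof.
rewrite A2l mulrBr mulrDr U2K bop_scaleAr mulr1 mulrBl mul1r mulrBr mulr1.
by rewrite opprB scaler_nat mulr2n opprD !addrA [_ + 1 - _]addrAC [_ - _ + 1 - _]addrAC.
Qed.

Lemma norm_bexp_A2_le t : 0 <= t -> `|bexp (A2 R) t| <= 1.
Proof. by move=> t0; rewrite A2l norm_bexp_laplacian// ?norm_U2 ?norm_U2V. Qed.

Lemma cvg_A2_bexp : `|A2 R * bexp (A2 R) t| @[t --> +oo] --> (0 : R).
Proof. by rewrite A2l; apply: cvg_laplacian_bexp; [exact: norm_U2|exact: norm_U2V]. Qed.

Lemma A2_U2 : A2 R * U2 R = U2 R * A2 R.
Proof.
by rewrite A2l mulrBr mulrBl mulrDr mulrDl U2K U2VK bop_scaleAr bop_scaleAl mulr1 mul1r.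
Qed.

(** The vectors whose orbit tends to 0 successively include the range of [A],
    the range of [U - 1], the unit vectors, and everything. *)
Lemma bexp_A2_cvg0 (x : ell2 R) : bexp (A2 R) t x @[t --> +oo] --> (0 : ell2 R).
Proof.
have E1 : \forall t \near +oo, `|bexp (A2 R) t| <= 1.
  near=> t; apply: norm_bexp_A2_le; near: t.
  by apply: nbhs_pinfty_ge; exact: num_real.
have rangeA z : bexp (A2 R) t (A2 R z) @[t --> +oo] --> (0 : ell2 R).
  apply: (@cvg0_norm_le _ _ _ _ _ _ (fun t => `|A2 R * bexp (A2 R) t| * `|z|)).
    by apply: nearW => t; rewrite -bopM -bexp_comm// le_opnorm.
  by rewrite -[X in _ --> X](mul0r `|z|); apply: cvgM cvg_A2_bexp (cvg_cst _).
have range1 z : bexp (A2 R) t ((U2 R - 1) z) @[t --> +oo] --> (0 : ell2 R).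
  apply: cvg0_range_sub1 norm_U2 E1 _ => {}z.
  have -> : (U2 R - 1) ((U2 R - 1) z) = A2 R (U2 R z).
    by rewrite -!bopM -U2_A2 A2_U2.
  exact: rangeA.
have cvg_delta m : bexp (A2 R) t (delta m) @[t --> +oo] --> (0 : ell2 R).
  apply: cvg0_closure E1 _ => e e0.
  have [|Y _ Ye] := @cesaro_approx _ _ (U2 R) (delta m) _ e e0; last first.
    by exists ((U2 R - 1) (Y (delta m))).
  (* The average of [delta m] has norm [1 / sqrt n], so [n > 1 / d^2] is enough. *)
  move=> d d0; pose n := (Num.truncn (d^-1 ^+ 2)).+1; exists n => //.
  rewrite norm_sum_U2X_delta -[X in _ <= X * _](sqr_sqrtr (ler0n R n)).
  have s0 : 0 < Num.sqrt n%:R :> R by rewrite sqrtr_gt0 ltr0n.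
  rewrite expr2 -mulrA ler_pMr// -ler_pdivrMr// mul1r.
  rewrite -[leLHS]ger0_norm ?invr_ge0 ?(ltW d0)// -sqrtr_sqr ler_wsqrtr//.
  by rewrite ltW// truncnS_gt.
apply: cvg0_closure E1 _ => e e0; have [F xF] := delta_dense x e0.
exists (\sum_(m <- F) x m *: delta m) => //.
under eq_cvg do rewrite linear_sum.
have : \sum_(m <- F) bexp (A2 R) t (x m *: delta m) @[t --> +oo] -->
    \sum_(m <- F) (0 : ell2 R).
  apply: cvg_big => [|m _]; first exact: add_continuous.
  under eq_cvg do rewrite linearZ.
  have : x m *: bexp (A2 R) t (delta m) @[t --> +oo] --> x m *: (0 : ell2 R).
    by apply: cvgZl_tmp; exact: cvg_delta.
  by rewrite scaler0.
by rewrite big1.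
Unshelve. all: by end_near. Qed.

(** The lower bound comes from the indicator [x] of [n] consecutive integers:
    [U A x = (U - 1) (U^n - 1) delta_0] has norm at most 4 while [x] has norm
    [sqrt n], so [e^{At}] moves [x] by a bounded amount only. *)
Lemma norm_bexp_A2 t : 0 <= t -> `|bexp (A2 R) t| = 1.
Proof.
move=> t0; apply/eqP; rewrite eq_le norm_bexp_A2_le//= leNgt; apply/negP => E1.
set E := bexp (A2 R) t in E1.
pose C := expR (`|t| * (1 + `|A2 R|)) * 4.
(* Large enough for [C < (1 - |E|) * sqrt n]. *)
pose n := (Num.truncn ((C / (1 - `|E|)) ^+ 2)).+1.
pose x := (\sum_(0 <= k < n) U2 R ^+ k) (delta 0).
have xn : `|x| = Num.sqrt n%:R by exact: norm_sum_U2X_delta.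
have d0 : 0 < 1 - `|E| by rewrite subr_gt0.
have D2 (y : ell2 R) : `|(U2 R - 1) y| <= 2 * `|y|.
  rewrite bopD bopN (le_trans (ler_normD _ _))// normrN mulr2n mulrDl !mul1r lerD//.
  by rewrite (le_trans (le_opnorm _ _))// ler_piMl//; exact: norm_U2.
have delta1 : `|delta 0 : ell2 R| = 1.
  by have := @norm_sum_U2X_delta R 1 0; rewrite big_nat1 expr0 sqrtr1.
have Ax : `|A2 R x| <= 4.
  rewrite -[A2 R x](_ : U2V R ((U2 R * A2 R) x) = _); last first.
    by rewrite -bopM mulrA U2VK mul1r.
  rewrite (le_trans (le_opnorm _ _))//.
  apply: (@le_trans _ _ `|(U2 R * A2 R) x|).
    by rewrite ler_piMl//; exact: norm_U2V.
  rewrite U2_A2 bopM (le_trans (D2 _))// /x -bopM subX1_geometric.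
  rewrite (_ : 4 = 2 * (1 + 1)) ?ler_pM2l//; last by ring.
  rewrite bopD bopN (le_trans (ler_normD _ _))// normrN lerD ?delta1//.
  rewrite (le_trans (le_opnorm _ _))// delta1 mulr1.
  by rewrite (le_trans (norm_bopX _ _))// exprn_ile1// norm_U2.
have Ex : `|x| - C <= `|E| * `|x|.
  apply: le_trans (le_opnorm E x); rewrite lerBlDr -lerBlDl.
  rewrite (le_trans (lerB_dist _ _))// distrC (le_trans (bexp_sub_le _ _ _))//.
  by rewrite ler_wpM2l ?expR_ge0.
have : C / (1 - `|E|) < `|x|.
  rewrite xn -[ltLHS]ger0_norm; last by rewrite divr_ge0 ?(ltW d0)// mulr_ge0 ?expR_ge0.
  by rewrite -sqrtr_sqr ltr_sqrt ?ltr0n// truncnS_gt.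
by rewrite ltr_pdivrMr//; move: Ex; lra.
Qed.

End Ell2Laplacian.

(** * The discrete Laplacian on l^oo *)

Section EllInfLaplacian.
Context {R : realType}.

Let AinfE1 : Ainf R = Uinf R + UinfV R - (2 : R) *: (1 : bop (ellinf R)).
Proof. by []. Qed.

Lemma norm_bexp_Ainf_le t : 0 <= t -> `|bexp (Ainf R) t| <= 1.
Proof. by move=> t0; rewrite AinfE1 norm_bexp_laplacian// ?norm_Uinf ?norm_UinfV. Qed.

Lemma cvg_Ainf_bexp : `|Ainf R * bexp (Ainf R) t| @[t --> +oo] --> (0 : R).
Proof. by rewrite AinfE1; apply: cvg_laplacian_bexp; [exact: norm_Uinf|exact: norm_UinfV]. Qed.

Lemma bounded_seq1 : bounded_seq (fun=> 1 : R).
Proof. by apply/bounded_seqE; exists 1 => n; rewrite normr1. Qed.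

(** Constant sequences are fixed, since [A] annihilates them. *)
Lemma norm_bexp_Ainf t : 0 <= t -> `|bexp (Ainf R) t| = 1.
Proof.
move=> t0; apply/eqP; rewrite eq_le norm_bexp_Ainf_le//=.
pose one := mk_ellinf bounded_seq1.
have one1 : `|one| = 1.
  apply/eqP; rewrite eq_le; apply/andP; split.
    by apply: supnorm_le => n; rewrite normr1.
  by have := ellinf_norm_ub one 0; rewrite normr1.
have A1 : Ainf R one = 0.
  apply/val_inj/funext => n; apply: etrans (AinfE one n) _.
  by rewrite /= mulr1 subrr.
have := le_opnorm (bexp (Ainf R) t) one.
by rewrite bexp_fixed// one1 mulr1.
Qed.

Lemma cvg_Ainf_bexp_app (x : ellinf R) :
  Ainf R (bexp (Ainf R) t x) @[t --> +oo] --> (0 : ellinf R).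
Proof.
apply: (@cvg0_norm_le _ _ _ _ _ _ (fun t => `|Ainf R * bexp (Ainf R) t| * `|x|)).
  by apply: nearW => t; rewrite -bopM; exact: le_opnorm.
by rewrite -[X in _ --> X](mul0r `|x|); apply: cvgM cvg_Ainf_bexp (cvg_cst _).
Qed.

End EllInfLaplacian.

Theorem theorem4 (R : realType) :
  [/\ (forall p : R -> ell2 R,
         solves (A2 R) p <-> forall t, 0 <= t -> p t = bexp (A2 R) t (p 0)) /\
      (forall p : R -> ellinf R,
         solves (Ainf R) p <->
         forall t, 0 <= t -> p t = bexp (Ainf R) t (p 0)),
      (forall t : R, 0 <= t -> `|bexp (A2 R) t| = 1) /\
      (forall p0 : ell2 R,
         supnorm (bexp (A2 R) t p0) @[t --> +oo] --> (0 : R) /\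
         forall y : ell2 R,
           dotz (bexp (A2 R) t p0) y @[t --> +oo] --> (0 : R))
    & [/\ (forall t : R, 0 <= t -> `|bexp (Ainf R) t| = 1),
          `|Ainf R * bexp (Ainf R) t| @[t --> +oo] --> (0 : R),
          (forall p0 : ellinf R,
             derive1 (fun s : R => bexp (Ainf R) s p0) t @[t --> +oo]
               --> (0 : ellinf R))
        & (forall p0 : ellinf R, range (Ainf R) p0 ->
             bexp (Ainf R) t p0 @[t --> +oo] --> (0 : ellinf R))]].
Proof.
split.
- by split=> p; exact: solvesP.
- split=> [t t0|p0]; first exact: norm_bexp_A2.
  have normp : `|bexp (A2 R) t p0| @[t --> +oo] --> (0 : R).
    by apply/norm_cvg0P; exact: bexp_A2_cvg0.
  split=> [|y].
    apply: cvg0_norm_le normp; apply: nearW => t.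
    by rewrite ger0_norm ?supnorm_ge0// supnorm_le_norm.
  apply: (@cvg0_norm_le _ _ _ _ _ _ (fun t => `|bexp (A2 R) t p0| * `|y|)).
    by apply: nearW => t; exact: dotz_cauchy_schwarz.
  by rewrite -[X in _ --> X](mul0r `|y|); apply: cvgM normp (cvg_cst _).
split=> [t t0||p0|p0 [x _ <-]].
- exact: norm_bexp_Ainf.
- exact: cvg_Ainf_bexp.
- under eq_cvg do rewrite derive1_bexp.
  exact: cvg_Ainf_bexp_app.
- under eq_cvg do rewrite -bopM -bexp_comm// bopM.
  exact: cvg_Ainf_bexp_app.
Qed.
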